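(* Let $n\ge 1$, let $\Omega\subset\mathbb{R}^n$ be a bounded smooth domain, let $0<s<1$ and $1<q<2^*_s$. Then there exists $\delta>0$ such that for every $0<\varepsilon<\delta$ the Sobolev constant $S(\Omega_\varepsilon)$ of the contracted domain $\Omega_\varepsilon=\{\varepsilon x : x\in\Omega\}$ has a unique extremal, up to multiplication by a nonzero real constant; that is, an extremal for $S(\Omega_\varepsilon)$ exists, and any two extremals for $S(\Omega_\varepsilon)$ are nonzero scalar multiples of each other.
   Context: A domain is a nonempty connected open set. $2^*_s:=\frac{2n}{n-2s}$ if $2s<n$ and $2^*_s:=\infty$ otherwise. For an open set $U\subset\mathbb{R}^n$, $\|u\|_{r;U}$ denotes the $L^r(U)$-norm, $[u]_{s;U}:=\left(\iint_{U\times U}\frac{(u(x)-u(y))^2}{|x-y|^{n+2s}}\,dx\,dy\right)^{1/2}$, $H^s(U):=\{u\in L^2(U): [u]_{s;U}<\infty\}$ (real-valued functions), with norm $\|u\|_{s;U}:=([u]_{s;U}^2+\|u\|_{2;U}^2)^{1/2}$. The Sobolev constant is $$S(U):=\inf_{u\in H^s(U),\,u\neq 0}\frac{\|u\|_{s;U}^2}{\|u\|_{q;U}^2},$$ and an extremal for $S(U)$ is a nonzero $u\in H^s(U)$ at which this infimum is attained. *)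

(* Defs.v *)
From HB Require Import structures.
From mathcomp Require Import all_boot all_order all_algebra.
From mathcomp Require Import all_classical all_reals all_analysis.

Set Implicit Arguments.
Unset Strict Implicit.
Unset Printing Implicit Defensive.

Import Order.TTheory GRing.Theory Num.Theory.
Import numFieldNormedType.Exports.

Local Open Scope classical_set_scope.
Local Open Scope ring_scope.

(* The sigma-algebra generated by the coordinate maps, as MathComp-Analysis
   does for n.-tuple R; it is the Borel sigma-algebra of 'rV[R]_n.  A Lebesgue
   measurable function agrees almost everywhere with a Borel one, so Borel
   representatives lose nothing in the spaces below. *)
Definition rV_display : measure_display.
Proof. exact: default_measure_display. Qed.

Section measurable_rV.
Context {R : realType} (n : nat).

Let coords : 'I_n -> 'rV[R]_n -> measurableTypeR R := fun i x => x 0 i.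

Let rV_set0 : g_sigma_preimage coords set0.
Proof. exact: sigma_algebra0. Qed.

Let rV_setC A : g_sigma_preimage coords A -> g_sigma_preimage coords (~` A).
Proof. exact: sigma_algebraC. Qed.

Let rV_bigcup (F : _^nat) : (forall i, g_sigma_preimage coords (F i)) ->
  g_sigma_preimage coords (\bigcup_i (F i)).
Proof. exact: sigma_algebra_bigcup. Qed.

HB.instance Definition _ := @isMeasurable.Build rV_display
  'rV[R]_n (g_sigma_preimage coords) rV_set0 rV_setC rV_bigcup.

End measurable_rV.

Lemma measurable_coord {R : realType} n (i : 'I_n) :
  measurable_fun [set: 'rV[R]_n] (fun x : 'rV[R]_n => x 0 i : measurableTypeR R).
Proof.
move=> _ Y mY; rewrite setTI; apply: sub_sigma_algebra => /=.
rewrite -bigcup_seq/=; exists i => /=; first by rewrite mem_index_enum.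
by exists Y => //; rewrite setTI.
Qed.

Lemma measurable_fun_coordP {R : realType} d (T : measurableType d) n
    (f : T -> 'rV[R]_n) :
  measurable_fun [set: T] f <->
  forall i, measurable_fun [set: T] (fun t => f t 0 i : measurableTypeR R).
Proof.
split=> [mf i|mf].
  exact: (measurableT_comp (measurable_coord i) mf).
pose c (i : 'I_n) (x : 'rV[R]_n) : measurableTypeR R := x 0 i.
suff: g_sigma_preimage (fun i => c i \o f) `<=` measurable.
  rewrite (@g_sigma_preimage_comp _ (measurableTypeR R) n 'rV[R]_n c T f) => H.
  by move=> _ A mA; apply: H; exists A.
apply: smallest_sub; first exact: sigma_algebra_measurable.
rewrite -bigcup_seq; apply: bigcup_sub => i _ _ [B mB <-].
exact: mf.
Qed.

Definition rV_cons {R : Type} {n : nat} (p : R * 'rV[R]_n) : 'rV[R]_n.+1 :=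
  \row_(i < n.+1) oapp (fun j : 'I_n => p.2 0 j) p.1 (unlift ord0 i).

Lemma rV_cons0 {R : Type} n (p : R * 'rV[R]_n) : rV_cons p 0 ord0 = p.1.
Proof. by rewrite mxE unlift_none. Qed.

Lemma rV_consS {R : Type} n (p : R * 'rV[R]_n) (j : 'I_n) :
  rV_cons p 0 (lift ord0 j) = p.2 0 j.
Proof. by rewrite mxE liftK. Qed.

Lemma measurable_rV_cons {R : realType} n :
  measurable_fun [set: measurableTypeR R * 'rV[R]_n] (@rV_cons R n).
Proof.
apply/measurable_fun_coordP => i; have [j ->|->] := unliftP ord0 i.
  rewrite (_ : (fun _ => _) = (fun x : 'rV[R]_n => x 0 j) \o snd); last first.
    by apply/funext => p /=; rewrite rV_consS.
  exact: (measurableT_comp (measurable_coord j) measurable_snd).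
rewrite (_ : (fun _ => _) = fst); last first.
  by apply/funext => p /=; rewrite rV_cons0.
exact: measurable_fst.
Qed.

Section lebesgue_rV_step.
Context {R : realType} (n : nat).
Variable mu : {sigma_finite_measure set 'rV[R]_n -> \bar R}.
Local Open Scope ereal_scope.

Definition lebesgue_rV_step : set 'rV[R]_n.+1 -> \bar R :=
  pushforward (@lebesgue_measure R \x mu) (@rV_cons R n).

Let measurable_preimage (A : set 'rV[R]_n.+1) : measurable A ->
  measurable ((@rV_cons R n : measurableTypeR R * 'rV[R]_n -> _) @^-1` A).
Proof.
by move=> mA; rewrite -[X in measurable X]setTI; exact: measurable_rV_cons.
Qed.

Let step0 : lebesgue_rV_step set0 = 0.
Proof. by rewrite /lebesgue_rV_step /pushforward preimage_set0 measure0. Qed.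

Let step_ge0 A : 0 <= lebesgue_rV_step A.
Proof. by rewrite /lebesgue_rV_step /pushforward; exact: measure_ge0. Qed.

Let step_sigma_additive : semi_sigma_additive lebesgue_rV_step.
Proof.
move=> F mF tF mUF; rewrite /lebesgue_rV_step /pushforward preimage_bigcup.
apply: measure_semi_sigma_additive.
- by move=> k; exact: measurable_preimage.
- apply/trivIsetP => /= i j _ _ ij; rewrite -preimage_setI.
  by move/trivIsetP : tF => /(_ _ _ _ _ ij) ->//; rewrite preimage_set0.
- by rewrite -preimage_bigcup; exact: measurable_preimage.
Qed.

HB.instance Definition _ := isMeasure.Build _ _ _ lebesgue_rV_step
  step0 step_ge0 step_sigma_additive.

Let rV_uncons (x : 'rV[R]_n.+1) : measurableTypeR R * 'rV[R]_n :=
  (x 0%R ord0, \row_j x 0%R (lift ord0 j)).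

Let rV_consK : cancel (@rV_cons R n) rV_uncons.
Proof.
move=> [a y]; rewrite /rV_uncons rV_cons0; congr pair.
by apply/rowP => j; rewrite mxE rV_consS.
Qed.

Let rV_unconsK : cancel rV_uncons (@rV_cons R n).
Proof.
move=> x; apply/rowP => i; have [j ->|->] := unliftP ord0 i.
  by rewrite rV_consS mxE.
by rewrite rV_cons0.
Qed.

Let measurable_rV_uncons : measurable_fun [set: 'rV[R]_n.+1] rV_uncons.
Proof.
apply/measurable_fun_pair; first exact: measurable_coord.
apply/measurable_fun_coordP => j.
rewrite (_ : (fun _ => _) = fun x : 'rV[R]_n.+1 => x 0%R (lift ord0 j)).
  exact: measurable_coord.
by apply/funext => x; rewrite mxE.
Qed.

Let step_sigma_finite : sigma_finite setT lebesgue_rV_step.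
Proof.
have /sigma_finiteP[F [TF ndF Foo]] := sigma_finiteT (@lebesgue_measure R).
have /sigma_finiteP[G [TG ndG Goo]] := sigma_finiteT mu.
exists (fun k => rV_uncons @^-1` (F k `*` G k)).
  rewrite -preimage_bigcup (_ : \bigcup_k _ = setT) ?preimage_setT//.
  rewrite -setXTT TF TG; apply/seteqP; split=> [[x y] [k _ []/= ? ?]|].
    by split; exists k.
  move=> [x y] [/= [k _ Fkx] [l _ Gly]]; exists (maxn k l) => //; split.
  - by move: x Fkx; exact/subsetPset/ndF/leq_maxl.
  - by move: y Gly; exact/subsetPset/ndG/leq_maxr.
move=> k; have [mF Fk] := Foo k; have [mG Gk] := Goo k; split.
  rewrite -[X in measurable X]setTI; apply: measurable_rV_uncons => //.
  exact: measurableX.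
rewrite /lebesgue_rV_step /pushforward -comp_preimage.
rewrite (_ : rV_uncons \o _ = id) ?preimage_id; last first.
  by apply/funext => p; exact: rV_consK.
by rewrite product_measure1E// lte_mul_pinfty// ge0_fin_numE.
Qed.

HB.instance Definition _ := Measure_isSigmaFinite.Build _ _ _
  lebesgue_rV_step step_sigma_finite.

End lebesgue_rV_step.

Fixpoint lebesgue_rV {R : realType} (n : nat) :
    {sigma_finite_measure set 'rV[R]_n -> \bar R} :=
  match n return {sigma_finite_measure set 'rV[R]_n -> \bar R} with
  | 0%N => \d_ (0 : 'rV[R]_0)
  | m.+1 => lebesgue_rV_step (lebesgue_rV m)
  end.

Arguments lebesgue_rV {R} n.

Lemma lebesgue_rV_box {R : realType} n (A : 'I_n -> set (measurableTypeR R)) :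
  (forall i, measurable (A i)) ->
  lebesgue_rV n [set x : 'rV[R]_n | forall i, A i (x 0 i)] =
  (\prod_(i < n) lebesgue_measure (A i))%E.
Proof.
elim: n A => [|n IHn] A mA.
  by rewrite big_ord0 /= diracE mem_set// => -[].
rewrite big_ord_recl -IHn//= /lebesgue_rV_step /pushforward.
rewrite -product_measure1E//; last first.
  rewrite [X in measurable X](_ : _ = \bigcap_(i in [set: 'I_n])
      ((fun x : 'rV[R]_n => x 0 i) @^-1` A (lift ord0 i))).
    apply: fin_bigcap_measurable => // i _.
    by rewrite -[X in measurable X]setTI; exact: measurable_coord.
  by apply/seteqP; split=> [x Ax i _|x Ax i]; exact: Ax.
congr (_ _); apply/seteqP; split=> [p /= Ap|p /= [Ap0 ApS] i].
  split=> [|i]; first by have := Ap ord0; rewrite rV_cons0.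
  by have := Ap (lift ord0 i); rewrite rV_consS.
by have [j ->|->] := unliftP ord0 i; rewrite ?rV_consS ?rV_cons0.
Qed.

Section smooth_domain.
Context {R : realType}.

Definition partial_derive m (i : 'I_m) (f : 'rV[R]_m -> R) : 'rV[R]_m -> R :=
  fun x => 'D_(delta_mx 0 i) f x.

Definition iter_partial_derive m (l : seq 'I_m) (f : 'rV[R]_m -> R) :=
  foldr (@partial_derive m) f l.

(* C^infinity: all iterated partial derivatives exist and are continuous. *)
Definition smooth m (f : 'rV[R]_m -> R) : Prop :=
  forall l : seq 'I_m, continuous (iter_partial_derive l f) /\
    forall (i : 'I_m) x, derivable (iter_partial_derive l f) x (delta_mx 0 i).

Definition boundary n (U : set 'rV[R]_n) : set 'rV[R]_n :=
  closure U `\` interior U.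

(* Near each boundary point, and after relabelling and reorienting the
   coordinate axes, U is the strict epigraph of a C^infinity function of the
   n - 1 remaining coordinates. *)
Definition smooth_boundary n (U : set 'rV[R]_n) : Prop :=
  forall x0, boundary U x0 ->
  exists (i : 'I_n) (b : bool) (g : 'rV[R]_n.-1 -> R), smooth g /\
    \forall x \near x0, U x <-> g (col' i x) < (-1) ^+ b * x 0 i.

Definition is_domain n (U : set 'rV[R]_n) : Prop :=
  [/\ U !=set0, connected U & open U].

Definition bounded_smooth_domain n (U : set 'rV[R]_n) : Prop :=
  [/\ is_domain U, bounded_set U & smooth_boundary U].

End smooth_domain.

Section fractional_sobolev.
Context {R : realType} {n : nat}.
Implicit Types (U : set 'rV[R]_n) (s q r : R) (u : 'rV[R]_n -> R).
Local Open Scope ereal_scope.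

(* The norm of MathComp-Analysis on 'rV[R]_n is the sup norm. *)
Definition euclid_norm (x : 'rV[R]_n) : R := Num.sqrt (\sum_i x 0%R i ^+ 2)%R.

Definition crit_exponent s : \bar R :=
  if (2 * s < n%:R)%R then (2 * n%:R / (n%:R - 2 * s))%:E else +oo.

Definition normL r U u : \bar R :=
  'N[lebesgue_rV n]_(r%:E)[EFin \o (u \_ U)%R].

(* On the diagonal, a null set, the integrand is 0 / 0 = 0. *)
Definition gagliardo s U u : \bar R :=
  (\int[lebesgue_rV n \x lebesgue_rV n]_(z in U `*` U)
     ((u z.1 - u z.2) ^+ 2
        / (euclid_norm (z.1 - z.2)) `^ (n%:R + 2 * s))%:E) `^ 2^-1.

Definition normH s U u : \bar R :=
  (gagliardo s U u ^+ 2 + normL 2 U u ^+ 2) `^ 2^-1.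

(* Elements of H^s(U) are classes of functions modulo equality almost
   everywhere on U; they are handled through representatives defined on the
   whole space, whose values outside U are irrelevant. *)
Definition ae_eq_on U u v : Prop :=
  {ae lebesgue_rV n, forall x, U x -> u x = v x}.

Definition H_space s U u : Prop :=
  [/\ measurable_fun U u, normL 2 U u < +oo & gagliardo s U u < +oo].

Definition H_space_neq0 s U u : Prop :=
  H_space s U u /\ ~ ae_eq_on U u (cst 0%R).

Definition sobolev_quotient s q U u : \bar R :=
  normH s U u ^+ 2 / normL q U u ^+ 2.

Definition sobolev_constant s q U : \bar R :=
  ereal_inf [set sobolev_quotient s q U u | u in H_space_neq0 s U].

Definition extremal s q U u : Prop :=
  H_space_neq0 s U u /\ sobolev_quotient s q U u = sobolev_constant s q U.

Definition contracted_domain (e : R) U : set 'rV[R]_n := [set e *: x | x in U]%R.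

End fractional_sobolev.

Arguments crit_exponent {R} n s.

(* Main.v *)
(** In the rescaled problem the seminorm carries the large factor [eps^(-2 s)],
    and for small [eps] the extremals are exactly the nonzero constants.  With
    [m = |U|], [U = Omega_eps] and [E u = eps^(2 s) [u]_s^2], it is enough that
      [m^(1 - 2 / q) |u|_q^2 <= |u|_2^2 + K E u]
    with [K] independent of [eps]: when [K eps^(2 s) < 1] this gives
    [S(U) = m^(1 - 2 / q)], attained at [1], and an extremal has [E u = 0].

    The inequality follows from
    [|z|^Q <= 1 + Q / 2 (z^2 - 1) + K ((z - 1)^2 + |z - 1|^Q)] applied to
    [z = u / u(x0)], and from [|u - u(x0)|_Q^2 <= C E u] for a suitable [x0].  The
    latter is trivial for [Q = 2] on a bounded set; it then improves itself: if it
    holds for [p], then averaging over [U cap B(x, t)] bounds [|u x|] by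
    [t^s G(x)^(1/2) + t^(-n / p)] where [E u] is the integral of [G], and
    optimizing in [t] gives it for [2 + (2 s / n) p].  The iterates of this
    affine map reach every subcritical exponent.  The only geometric input is
    that [U cap B(x, r)] contains a cube of size comparable to [r]. *)
Require Import Defs.
From mathcomp Require Import all_boot all_order all_algebra.
From mathcomp Require Import all_classical all_reals all_analysis.
From mathcomp Require Import measurable_realfun ring lra.
Import Order.TTheory GRing.Theory Num.Theory.
Import numFieldNormedType.Exports.
Set Implicit Arguments.
Unset Strict Implicit.
Unset Printing Implicit Defensive.
Local Open Scope classical_set_scope.
Local Open Scope ring_scope.

(** * Real inequalities *)
Section powR_inequalities.
Context {R : realType}.
Implicit Types a b x y z Q : R.

(** Young's inequality for the product [y * 1] with the conjugate exponents [a] and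
    [a / (a - 1)]. *)
Lemma bernoulli_powR a y : 1 <= a -> 0 <= y -> 1 + a * (y - 1) <= y `^ a.
Proof.
rewrite le_eqVlt => /predU1P[<- y0|a1 y0]; first by rewrite powRr1//; lra.
have a0 : 0 < a by lra.
have b0 : 0 < a / (a - 1) by rewrite divr_gt0//; lra.
have /(_ _)/= := @conjugate_powR R y 1 a (a / (a - 1)) y0 ler01 a0 b0 _.
have -> : a^-1 + (a / (a - 1))^-1 = 1 by field; rewrite gt_eqF//=; lra.
move=> /(_ erefl); rewrite mulr1 powR1 /= invf_div mul1r.
rewrite -(ler_pM2l a0) mulrDr mulrCA mulfV ?gt_eqF// mulr1 mulrCA mulfV ?gt_eqF//.
lra.
Qed.

Lemma bernoulli_powR_le1 a y :
  0 < a <= 1 -> 0 <= y -> y `^ a <= 1 + a * (y - 1).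
Proof.
move=> /andP[a0 a1] y0.
have := @bernoulli_powR a^-1 (y `^ a) _ (powR_ge0 _ _).
rewrite invf_ge1// -powRrM mulfV ?gt_eqF// powRr1// => /(_ a1).
rewrite -(ler_pM2l a0) mulrDr mulrA mulfV ?gt_eqF//; lra.
Qed.

(** Raising the exponent from [a] to the integer [M] increases the left side on both sides of
    [y = 1], because [y - 1] changes sign there. Then [y ^+ M - 1] factors as [y - 1] times a
    geometric sum whose terms are at most [3 ^ M]. *)
Lemma powR_sub1_mul_le a y (M : nat) : 0 <= a <= M%:R -> 0 <= y <= 3 ->
  (y `^ a - 1) * (y - 1) <= (M * 3 ^ M)%:R * (y - 1) ^+ 2.
Proof.
move=> /andP[a0 aM] /andP[]; rewrite le_eqVlt => /predU1P[<- _|y0 y3].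
  rewrite sub0r sqrrN expr1n mulr1 mulrN1 opprB -subr_ge0.
  (* At [y = 0] the convention 0^0 = 1 makes [a = 0] a separate case. *)
  have [->|a_neq0] := eqVneq a 0; first by rewrite powRr0 subrr subr0.
  rewrite powR0// subr0 subr_ge0 ler1n muln_gt0 expn_gt0 andbT.
  by rewrite lt0n; apply: contraTneq aM => ->; rewrite -ltNge lt_neqAle eq_sym a_neq0.
have /le_trans : (y `^ a - 1) * (y - 1) <= (y ^+ M - 1) * (y - 1).
  rewrite -(powR_mulrn _ (ltW y0)); have [y1|y1] := leP 1 y.
    by apply: ler_wpM2r; rewrite ?subr_ge0// lerD2r ler_powR.
  by apply: ler_wnM2r; rewrite ?subr_le0 ?(ltW y1)// lerD2r ger_powR// y0 ltW.
apply; rewrite subrX1 -mulrA mulrCA -expr2 ler_wpM2r ?sqr_ge0//.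
apply: (@le_trans _ _ (\sum_(i < M) (3 ^ M)%:R)).
  apply: ler_sum => i _; rewrite natrX.
  apply: (@le_trans _ _ (3 ^+ i)); first by rewrite lerXn2r ?nnegrE// ltW.
  by rewrite ler_eXn2l ?ltr1n// ltnW.
by rewrite sumr_const card_ord -[leLHS]mulr_natl natrM.
Qed.

(** In the variable [y = z ^+ 2] the affine part is the tangent at 1 of y^(Q/2). Near [z = 1] the
    error is quadratic in [y - 1], hence in [z - 1]; away from 1 the term |z - 1|^Q dominates
    everything. *)
Lemma powR_le_quadratic Q : 2 < Q -> exists2 K : R, 0 < K & forall z,
  `|z| `^ Q <= 1 + Q / 2 * (z ^+ 2 - 1) + K * ((z - 1) ^+ 2 + `|z - 1| `^ Q).
Proof.
move=> Q2; have a1 : 1 <= Q / 2 by lra.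
pose M := (Num.truncn Q).+1.
have aM : 0 <= Q / 2 - 1 <= M%:R.
  have := truncnS_gt Q; rewrite -/M; lra.
pose C : R := (M * 3 ^ M)%:R; have C0 : 0 <= C by rewrite ler0n.
exists (3 `^ Q + Q * 2 `^ Q + Q * C * 9) => [|z].
  rewrite -addrA ltr_wpDr ?powR_gt0// addr_ge0 ?mulr_ge0 ?powR_ge0//; lra.
set y := z ^+ 2.
have zQ : `|z| `^ Q = y `^ (Q / 2).
  rewrite /y -(real_normK (num_real z)) -powR_mulrn// -powRrM.
  by congr (_ `^ _); field.
have y0 : 0 <= y by exact: sqr_ge0.
have D0 : 0 <= `|z - 1| `^ Q by exact: powR_ge0.
(* Far case: |z| is at most 3 |z - 1|, and the possibly negative affine part, at least 1 - Q/2, is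
   absorbed by the summand Q 2^Q of the constant, since 2 |z - 1| is at least 1. *)
have [z1|z1] := leP (2^-1) `|z - 1|.
  have D1 : 1 <= 2 `^ Q * `|z - 1| `^ Q.
    rewrite -powRM//.
    rewrite [leLHS](_ : 1 = 1 `^ Q); last by rewrite powR1.
    by rewrite ge0_ler_powR ?nnegrE//; lra.
  have zD : `|z| `^ Q <= 3 `^ Q * `|z - 1| `^ Q.
    rewrite -powRM// ge0_ler_powR ?nnegrE//; first lra.
    have := ler_normD (z - 1) 1; rewrite subrK normr1; lra.
  have K1 : 0 <= (z - 1) ^+ 2 := sqr_ge0 _.
  have P3 : 0 <= 3 `^ Q by exact: powR_ge0.
  have P2 : 0 <= 2 `^ Q by exact: powR_ge0.
  have : 0 <= (3 `^ Q + Q * 2 `^ Q + Q * C * 9) * (z - 1) ^+ 2.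
    by rewrite mulr_ge0// !addr_ge0// !mulr_ge0//; lra.
  have : 0 <= (Q * C * 9) * `|z - 1| `^ Q by rewrite !mulr_ge0//; lra.
  have := ler_wpM2l (_ : 0 <= Q) D1; rewrite mulr1 => /(_ _)/=; nra.
have /andP[zl zu] : 2^-1 <= z <= 3 / 2.
  by move: z1; rewrite ltr_norml => /andP[]; lra.
have y3 : 0 <= y <= 3 by rewrite y0 /y expr2; nra.
have y_gt0 : 0 < y by rewrite /y exprn_gt0//; lra.
(* Convexity with the tangent taken at [y] and evaluated at 1: Bernoulli at [y^-1], multiplied by
   y^(Q/2). *)
have tangent : y `^ (Q / 2) <= 1 + Q / 2 * (y `^ (Q / 2 - 1) * (y - 1)).
  have yV0 : 0 <= y^-1 by rewrite invr_ge0.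
  have := bernoulli_powR a1 yV0.
  rewrite -(ler_pM2l (powR_gt0 (Q / 2) y_gt0)) -powRM ?invr_ge0//.
  rewrite mulfV ?gt_eqF// powR1 mulrDr mulr1.
  rewrite (_ : y `^ (Q / 2 - 1) = y `^ (Q / 2) * y^-1); last first.
    by rewrite powRB ?powRr1// (gt_eqF y_gt0) implybT.
  have -> : y `^ (Q / 2) * y^-1 * (y - 1) = y `^ (Q / 2) * (1 - y^-1).
    by rewrite -mulrA mulrBr mulr1 mulVf ?gt_eqF.
  lra.
have := powR_sub1_mul_le aM y3; rewrite -/C => pM.
have ysq : (y - 1) ^+ 2 <= 9 * (z - 1) ^+ 2.
  rewrite (_ : y - 1 = (z - 1) * (z + 1)); last by rewrite /y; ring.
  by rewrite exprMn mulrC ler_wpM2r ?sqr_ge0// expr2; nra.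
have P3 : 0 <= 3 `^ Q by exact: powR_ge0.
have P2 : 0 <= 2 `^ Q by exact: powR_ge0.
rewrite zQ (le_trans tangent)// -addrA lerD2l -lerBlDl -mulrBr.
have -> : y `^ (Q / 2 - 1) * (y - 1) - (y - 1) = (y `^ (Q / 2 - 1) - 1) * (y - 1).
  by ring.
have Q0 : 0 <= Q / 2 by lra.
apply: (le_trans (ler_wpM2l Q0 (le_trans pM (ler_wpM2l C0 ysq)))).
have : 0 <= (3 `^ Q + Q * 2 `^ Q) * ((z - 1) ^+ 2 + `|z - 1| `^ Q).
  by rewrite mulr_ge0 ?addr_ge0 ?sqr_ge0 ?mulr_ge0//; lra.
have QC0 : 0 <= Q * C * 9 by rewrite !mulr_ge0//; lra.
have := mulr_ge0 QC0 D0; have := mulr_ge0 QC0 (sqr_ge0 (z - 1)).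
rewrite !mulrDl !mulrDr; lra.
Qed.

End powR_inequalities.

(* The affine map [p |-> 2 + th * p], whose fixed point for [th < 1] is the
   critical exponent when [th = 2 s / n]. *)
Lemma le_iter_affine (R : realType) (th q : R) :
  0 < th -> (th < 1 -> q < 2 / (1 - th)) ->
  exists j, q <= iter j (fun p => 2 + th * p) 2.
Proof.
move=> th0 qcrit; set f := fun p => 2 + th * p; have [th1|th1] := ltP th 1.
  have t1 : 0 < 1 - th by lra.
  (* The distance to the fixed point contracts by the factor [th], so the iterates converge to
     it. *)
  have fE j : iter j f 2 = 2 / (1 - th) - th ^+ j * (2 / (1 - th) - 2).
    elim: j => [|j IHj]; first by rewrite expr0 mul1r /=; lra.
    rewrite iterS IHj /f exprS; field; lra.
  have := @cvg_expr R th; rewrite ger0_norm ?ltW// => /(_ th1)/cvgrPdist_lt.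
  pose L := 2 / (1 - th).
  have L0 : 0 < L + 1 by rewrite addr_gt0// divr_gt0.
  have e0 : 0 < (L - q) / (L + 1) by rewrite divr_gt0// subr_gt0 qcrit.
  move=> /(_ _ e0)[j _ /(_ j (leqnn j))]; rewrite /= sub0r normrN.
  rewrite ger0_norm ?exprn_ge0 ?ltW// ltr_pdivlMr// -/L => lt.
  exists j; rewrite fE -/L; have := exprn_ge0 j (ltW th0); nra.
(* For [th >= 1] each step adds at least 2, so the iterates grow at least linearly. *)
exists (Num.truncn q); apply: (@le_trans _ _ (2 * (Num.truncn q).+1%:R)).
  have := truncnS_gt q; have : 0 <= (Num.truncn q).+1%:R :> R by rewrite ler0n.
  lra.
elim: (Num.truncn q) => [|j]; first by rewrite mulr1.
rewrite iterS; move: (iter j f 2) => p; rewrite /f -[j.+2%:R]natr1.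
have : 1 <= j.+1%:R :> R by rewrite ler1n.
nra.
Qed.

(** * Energies and moments for an abstract kernel *)

Section energy.
Context d (T : measurableType d) (R : realType).
Variable mu : {sigma_finite_measure set T -> \bar R}.
Implicit Types (A U : set T) (w f : T -> R) (k : T * T -> R) (a b c m p : R).
Local Open Scope ereal_scope.

(** The negative constant [- b] is carried on the left, so that only integrals of nonnegative
    functions are split and no integrability has to be known beforehand. *)
Lemma integral_le3 U (f f1 f2 f3 : T -> \bar R) (a1 a2 a3 b m F1 F2 F3 : R) :
  measurable U -> mu U = m%:E ->
  measurable_fun U f -> measurable_fun U f1 ->
  measurable_fun U f2 -> measurable_fun U f3 ->
  (forall x, U x -> 0 <= f x) -> (forall x, U x -> 0 <= f1 x) ->
  (forall x, U x -> 0 <= f2 x) -> (forall x, U x -> 0 <= f3 x) ->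
  (0 <= a1)%R -> (0 <= a2)%R -> (0 <= a3)%R -> (0 <= b)%R ->
  (forall x, U x ->
    f x + b%:E <= a1%:E * f1 x + a2%:E * f2 x + a3%:E * f3 x) ->
  \int[mu]_(x in U) f1 x <= F1%:E -> \int[mu]_(x in U) f2 x <= F2%:E ->
  \int[mu]_(x in U) f3 x <= F3%:E ->
  \int[mu]_(x in U) f x <= (a1 * F1 + a2 * F2 + a3 * F3 - b * m)%:E.
Proof.
move=> mU muU mf mf1 mf2 mf3 f0 f10 f20 f30 a10 a20 a30 b0 le I1 I2 I3.
have mz (a : R) (g : T -> \bar R) : measurable_fun U g ->
    measurable_fun U (fun x => a%:E * g x).
  by move=> mg; exact: measurable_funeM.
have /le_trans : \int[mu]_(x in U) (f x + b%:E) <=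
    \int[mu]_(x in U) (a1%:E * f1 x + a2%:E * f2 x + a3%:E * f3 x).
  apply: ge0_le_integral => //.
  - by move=> x Ux; rewrite adde_ge0 ?f0.
  - exact: emeasurable_funD.
  - by apply: emeasurable_funD; [apply: emeasurable_funD|]; exact: mz.
rewrite (@ge0_integralD _ _ _ mu U mU f (fun=> b%:E))// (_ : \int[mu]_(x in U) b%:E = (b * m)%:E); last first.
  by rewrite EFinM -muU -integral_cst.
rewrite ge0_integralD//; last 4 first.
- by move=> x Ux; rewrite adde_ge0// mule_ge0 ?f10 ?f20.
- by apply: emeasurable_funD; exact: mz.
- by move=> x Ux; rewrite mule_ge0 ?f30.
- exact: mz.
rewrite ge0_integralD//; last 4 first.
- by move=> x Ux; rewrite mule_ge0 ?f10.
- exact: mz.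
- by move=> x Ux; rewrite mule_ge0 ?f20.
- exact: mz.
rewrite !ge0_integralZl_EFin// => /(_ (a1 * F1 + a2 * F2 + a3 * F3)%:E).
rewrite EFinB leeBrDr// => -> //.
by rewrite !EFinD !EFinM !leeD// lee_wpmul2l.
Qed.

(** Otherwise f / (3 a) + g / (3 b) is at least 1 on all of [A], and integrating bounds [mu A] by 2
    m / 3. *)
Lemma exists_le_average A (f g : T -> \bar R) a b m :
  measurable A -> (0 < a)%R -> (0 < b)%R -> (0 < m)%R -> m%:E <= mu A ->
  measurable_fun A f -> measurable_fun A g ->
  (forall x, A x -> 0 <= f x) -> (forall x, A x -> 0 <= g x) ->
  \int[mu]_(x in A) f x <= (a * m)%:E -> \int[mu]_(x in A) g x <= (b * m)%:E ->
  exists y, [/\ A y, f y <= (3 * a)%:E & g y <= (3 * b)%:E].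
Proof.
move=> mA a0 b0 m0 mmu mf mg f0 g0 fa gb; apply: contrapT => nex.
have ca : (0 < (3 * a)^-1)%R by rewrite invr_gt0 mulr_gt0.
have cb : (0 < (3 * b)^-1)%R by rewrite invr_gt0 mulr_gt0.
have mz (c : R) (h : T -> \bar R) : measurable_fun A h ->
    measurable_fun A (fun x => c%:E * h x).
  by move=> mh; exact: measurable_funeM.
have : \int[mu]_(x in A) (cst 1 x) <=
    \int[mu]_(x in A) ((3 * a)^-1%:E * f x + (3 * b)^-1%:E * g x).
  apply: ge0_le_integral => //; first by apply: emeasurable_funD; exact: mz.
  move=> x Ax /=; have [fx|fx] := leP (f x) (3 * a)%:E.
    have [gx|gx] := leP (g x) (3 * b)%:E; first by case: nex; exists x.
    rewrite -[leLHS]add0e leeD// ?mule_ge0 ?f0 ?lee_fin ?(ltW ca)//.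
    by rewrite lee_pdivlMl ?mulr_gt0// mule1 ltW.
  rewrite -[leLHS]adde0 leeD// ?mule_ge0 ?g0 ?lee_fin ?(ltW cb)//.
  by rewrite lee_pdivlMl ?mulr_gt0// mule1 ltW.
rewrite integral_cst// mul1e ge0_integralD//; last 4 first.
- by move=> x Ax; rewrite mule_ge0 ?f0// lee_fin ltW.
- exact: mz.
- by move=> x Ax; rewrite mule_ge0 ?g0// lee_fin ltW.
- exact: mz.
rewrite !ge0_integralZl_EFin ?(ltW ca) ?(ltW cb)//.
move=> muA_le; have := le_trans mmu muA_le; rewrite leNgt => /negP; apply.
apply: (@le_lt_trans _ _ ((3 * a)^-1%:E * (a * m)%:E + (3 * b)^-1%:E * (b * m)%:E)).
  by rewrite leeD// lee_wpmul2l// lee_fin ltW.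
rewrite -!EFinM -EFinD lte_fin.
have -> : ((3 * a)^-1 * (a * m) + (3 * b)^-1 * (b * m) = 2 / 3 * m)%R.
  by field; rewrite !gt_eqF.
lra.
Qed.

Definition inner_energy U k w x :=
  \int[mu]_(y in U) (k (x, y) * (w x - w y) ^+ 2)%:E.

Definition energy U k w := \int[mu]_(x in U) inner_energy U k w x.

Definition moment p U w := \int[mu]_(x in U) (`|w x| `^ p)%:E.

(* [k] behaves on [U] like [|x - y|^-(N + 2 s)] on a domain of dimension [N],
   up to the constant [c] and in units where [U] has size 1. *)
Record sobolev_kernel (c N s m : R) U k : Prop := SobolevKernel {
  sk_measurable_set : measurable U;
  sk_mass : mu U = m%:E;
  sk_mass_gt0 : (0 < m)%R;
  sk_measurable : measurable_fun [set: T * T] k;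
  sk_ge0 : forall z, (0 <= k z)%R;
  sk_far : forall x y, U x -> U y -> x <> y -> (c <= k (x, y) * m)%R;
  sk_near : forall x t, U x -> (0 < t <= 1)%R ->
    exists A, [/\ measurable A, A `<=` U, (c * t `^ N * m)%:E <= mu A &
      forall y, A y -> x <> y -> (c * t `^ (- (N + 2 * s)) <= k (x, y) * m)%R] }.

Lemma measurable_moment p U w : measurable_fun setT w ->
  measurable_fun U (fun x => (`|w x| `^ p)%:E).
Proof.
move=> mw; apply: measurable_funTS; apply/measurable_EFinP.
apply: (measurableT_comp (measurable_powR _)).
exact: measurableT_comp.
Qed.

Lemma measurable_energy_integrand k w :
  measurable_fun [set: T * T] k -> measurable_fun setT w ->
  measurable_fun [set: T * T]
    (fun z => (k z * (w z.1 - w z.2) ^+ 2)%:E).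
Proof.
move=> mk mw; apply/measurable_EFinP; apply: measurable_funM => //.
by apply: measurable_funX; apply: measurable_funB; exact: measurableT_comp.
Qed.

Lemma measurable_inner_energy_integrand k w x :
  measurable_fun [set: T * T] k -> measurable_fun setT w ->
  measurable_fun setT (fun y => (k (x, y) * (w x - w y) ^+ 2)%:E).
Proof.
move=> mk mw.
exact: (measurableT_comp (measurable_energy_integrand mk mw)
  (pair1_measurable x)).
Qed.

Lemma measurable_inner_energy U k w : measurable U ->
  measurable_fun [set: T * T] k -> (forall z, (0 <= k z)%R) ->
  measurable_fun setT w -> measurable_fun setT (inner_energy U k w).
Proof.
move=> mU mk k0 mw.
pose f (z : T * T) := (((k z * (w z.1 - w z.2) ^+ 2)%:E) * (\1_U z.2)%:E).
have -> : inner_energy U k w = fun x => \int[mu]_y f (x, y).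
  apply/funext => x; rewrite /inner_energy integral_mkcond.
  apply: eq_integral => y _; rewrite /f patchE/= indicE.
  by case: ifPn => _; rewrite ?mule1 ?mule0.
apply: (@measurable_fun_fubini_tonelli_F _ _ _ _ _ mu f).
- apply: emeasurable_funM; first exact: measurable_energy_integrand.
  apply/measurable_EFinP; apply: (measurableT_comp _ measurable_snd).
  exact: measurable_indic.
- move=> z; rewrite /f -EFinM lee_fin indicE mulr_ge0//.
  exact: mulr_ge0 (k0 z) (sqr_ge0 _).
Qed.

End energy.

Arguments moment {d T R} mu p%_R U w.

(** * Pointwise bound that raises the moment exponent *)

Section embedding.
Context d (T : measurableType d) (R : realType).
Variable mu : {sigma_finite_measure set T -> \bar R}.
Variables (c N s : R).
Hypotheses (c0 : 0 < c) (N0 : 0 < N) (s0 : 0 < s).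
Implicit Types (U : set T) (w : T -> R) (k : T * T -> R) (m p q K : R).

(* Compare [w x] with [w y] for a typical [y] in the set of size [t ^ N] given
   by [sk_near]; the two bounds below balance when [G = t ^ -2(s + N / p)]. *)
Lemma pointwise_moment_bound p B : 0 < p -> 0 < B -> exists2 C : R, 0 < C &
  forall U k m w x, sobolev_kernel mu c N s m U k -> measurable_fun setT w ->
    (moment mu p U w <= (B * m)%:E)%E -> U x ->
    ((`|w x| `^ (2 + 2 * s / N * p))%:E <=
       C%:E * (1 + inner_energy mu U k w x))%E.
Proof.
move=> p0 B0.
set p' := 2 + 2 * s / N * p.
have p'0 : 0 < p' by rewrite addr_gt0// mulr_gt0// divr_gt0// mulr_gt0.
(* The two summands are the coefficients of t^(-N/p) in the bounds on |w x - w y| and on |w y|. *)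
pose C1 := Num.sqrt (3 * c ^- 2) + (3 * (B / c)) `^ p^-1.
have C10 : 0 < C1.
  by rewrite ltr_wpDl// ?sqrtr_ge0// powR_gt0// mulr_gt0// divr_gt0.
exists (C1 `^ p') => [|U k m w x sk mw wB Ux]; first exact: powR_gt0.
have [mU muU m0 mk k0 kfar knear] := sk.
have Gm : measurable_fun setT (fun y => (k (x, y) * (w x - w y) ^+ 2)%:E).
  exact: measurable_inner_energy_integrand.
have integrand_ge0 y : (0 <= (k (x, y) * (w x - w y) ^+ 2)%:E)%E.
  by rewrite lee_fin (mulr_ge0 (k0 _) (sqr_ge0 _)).
have G0 : (0 <= inner_energy mu U k w x)%E by apply: integral_ge0.
move: G0; case GE : (inner_energy mu U k w x) => [G| |//]; last first.
  by move=> _; rewrite addey// gt0_muley ?leey// lte_fin powR_gt0.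
rewrite lee_fin => G0; rewrite -EFinD -EFinM lee_fin.
(* The balance is 1 + G = t^(-e); adding 1 to [G] ensures [t <= 1], the range of scales in
   [sk_near]. *)
pose e := 2 * s + 2 * (N / p).
have e0 : 0 < e by rewrite addr_gt0// mulr_gt0// divr_gt0.
have G10 : 0 < 1 + G by rewrite ltr_wpDr.
pose t := (1 + G) `^ (- e^-1).
have t0 : 0 < t by exact: powR_gt0.
have t1 : t <= 1.
  rewrite /t powRN invf_le1 ?powR_gt0//.
  rewrite [leLHS](_ : 1 = (1 + G) `^ 0); last by rewrite powRr0.
  by rewrite ler_powR ?lerDl// invr_ge0 ltW.
have tE r : (1 + G) `^ r = t `^ (- (e * r)).
  by rewrite /t -powRrM; congr (_ `^ _); field; rewrite gt_eqF.
clearbody t; have [|A [mA AU muA kA]] := knear x t Ux; first by rewrite t0.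
pose M := c * t `^ N * m.
have M0 : 0 < M by rewrite !mulr_gt0// powR_gt0.
(* With [M] the lower bound on the mass of [A], the integrals over [A] of (w x - w y)^2 and of |w
   y|^p are at most [a * M] and [b * M]. *)
pose a := c ^- 2 * t `^ (- (2 * (N / p))).
pose b := B / c * t `^ (- N).
have a0 : 0 < a by rewrite mulr_gt0 ?invr_gt0 ?exprn_gt0 ?powR_gt0.
have b0 : 0 < b by rewrite mulr_gt0 ?divr_gt0 ?powR_gt0.
have mwx : measurable_fun setT (fun y => ((w x - w y) ^+ 2)%:E).
  apply/measurable_EFinP/measurable_funX; exact: measurable_funB.
have Ia : (\int[mu]_(y in A) ((w x - w y) ^+ 2)%:E <= (a * M)%:E)%E.
  pose D := m / (c * t `^ (- (N + 2 * s))).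
  have D0 : 0 < D by rewrite divr_gt0// mulr_gt0// powR_gt0.
  have -> : a * M = D * (1 + G).
    rewrite -[in RHS](powRr1 (ltW G10)) tE mulr1.
    rewrite /a /M /D /e !powRN.
    have tD r1 r2 : t `^ (r1 + r2) = t `^ r1 * t `^ r2.
      by rewrite powRD// (gt_eqF t0) implybT.
    by rewrite !tD; field; rewrite !gt_eqF// powR_gt0.
  apply: (@le_trans _ _ (\int[mu]_(y in A)
      (D%:E * (k (x, y) * (w x - w y) ^+ 2)%:E))%E).
    apply: ge0_le_integral => //.
    - by move=> y _; rewrite lee_fin sqr_ge0.
    - exact: measurable_funTS.
    - by apply: measurable_funeM; exact: measurable_funTS.
    - move=> y Ay; rewrite -EFinM lee_fin mulrA.
      (* The lower bound on [k] is available off the diagonal only; on it the difference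
         vanishes. *)
      have [<-|/eqP xy] := eqVneq x y; first by rewrite subrr expr0n mulr0.
      rewrite ler_peMl ?sqr_ge0// mulrAC [m * _]mulrC ler_pdivlMr ?mul1r ?kA//.
      by rewrite mulr_gt0// powR_gt0.
  rewrite ge0_integralZl_EFin//; [|exact: measurable_funTS|exact: ltW].
  rewrite (EFinM D) lee_wpmul2l ?lee_fin ?(ltW D0)//.
  apply: (@le_trans _ _ G%:E); last by rewrite lee_fin lerDr.
  rewrite -GE; apply: ge0_subset_integral => //.
  exact: measurable_funTS.
have Ib : (\int[mu]_(y in A) (`|w y| `^ p)%:E <= (b * M)%:E)%E.
  have -> : b * M = B * m.
    by rewrite /b /M powRN; field; rewrite !gt_eqF// powR_gt0//.
  apply: le_trans wB; apply: ge0_subset_integral => //.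
  exact: measurable_moment.
have [y [Ay ya yb]] : exists y, [/\ A y, ((w x - w y) ^+ 2)%:E <= (3 * a)%:E &
    (`|w y| `^ p)%:E <= (3 * b)%:E]%E.
  apply: (exists_le_average mA a0 b0 M0 muA) => //.
  - exact: measurable_funTS.
  - exact: measurable_moment.
  - by move=> y _; rewrite lee_fin sqr_ge0.
rewrite !lee_fin in ya yb.
have Bc : 0 < 3 * (B / c) by rewrite mulr_gt0// divr_gt0.
have wx : `|w x| <= C1 * t `^ (- (N / p)).
  rewrite mulrDl -(subrK (w y) (w x)) (le_trans (ler_normD _ _))// lerD//.
    rewrite -sqrtr_sqr; have := ler_wsqrtr ya => /le_trans; apply.
    rewrite /a mulrA sqrtrM; last by rewrite mulr_ge0// invr_ge0 sqr_ge0.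
    have -> : Num.sqrt (t `^ (- (2 * (N / p)))) = t `^ (- (N / p)).
      rewrite -(powR12_sqrt (powR_ge0 _ _)) -powRrM.
      by congr (_ `^ _); field; rewrite gt_eqF.
    by [].
  have -> : `|w y| = (`|w y| `^ p) `^ p^-1.
    by rewrite -powRrM divff ?gt_eqF// powRr1.
  apply: (@le_trans _ _ ((3 * b) `^ p^-1)).
    by rewrite ge0_ler_powR ?nnegrE ?invr_ge0 ?(ltW p0)// ?powR_ge0// mulr_ge0// ltW.
  rewrite /b mulrA powRM; [|exact: ltW|exact: powR_ge0].
  by rewrite -powRrM mulNr.
(* The exponent [p'] is the one for which (N / p) p' = e, so the power of [t] is exactly 1 + G. *)
apply: (@le_trans _ _ ((C1 * t `^ (- (N / p))) `^ p')).
  by rewrite ge0_ler_powR ?nnegrE ?(ltW p'0)// mulr_ge0 ?powR_ge0// ltW.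
rewrite powRM ?powR_ge0 ?(ltW C10)// ler_wpM2l ?powR_ge0//.
rewrite -[leRHS](powRr1 (ltW G10)) tE mulr1 -powRrM.
rewrite le_eqVlt; apply/orP; left; apply/eqP; congr (_ `^ _).
by rewrite /e /p'; field; rewrite !gt_eqF.
Qed.

End embedding.

(** * Poincare-Sobolev inequalities with uniform constants *)

Section poincare_sobolev.
Context d (T : measurableType d) (R : realType).
Variable mu : {sigma_finite_measure set T -> \bar R}.
Variables (c N s : R).
Hypotheses (c0 : 0 < c) (N0 : 0 < N) (s0 : 0 < s).
Implicit Types (U : set T) (w : T -> R) (k : T * T -> R) (a m p q K Q z : R).

Let step := fun p : R => 2 + 2 * s / N * p.
Let expo j := iter j step 2.

Lemma integral_mass U m b : measurable U -> mu U = m%:E ->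
  (\int[mu]_(x in U) b%:E = (b * m)%:E)%E.
Proof. by move=> mU muU; rewrite EFinM -muU -integral_cst. Qed.

Lemma inner_energy_ge0 U k w x :
  (forall xy : T * T, 0 <= k xy) -> (0 <= inner_energy mu U k w x)%E.
Proof.
move=> k0; apply: integral_ge0 => y _.
by rewrite lee_fin (mulr_ge0 (k0 _) (sqr_ge0 _)).
Qed.

Lemma energy_affine U m k w a z : sobolev_kernel mu c N s m U k ->
  measurable_fun setT w ->
  (energy mu U k (fun x => a * (w x - z))%R = (a ^+ 2)%:E * energy mu U k w)%E.
Proof.
move=> [mU muU m0 mk k0 _ _] mw; rewrite /energy -ge0_integralZl_EFin//.
- apply: eq_integral => x _; rewrite /inner_energy -ge0_integralZl_EFin//.
  + by apply: eq_integral => y _; rewrite -EFinM; congr EFin; ring.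
  + by move=> y _; rewrite lee_fin (mulr_ge0 (k0 _) (sqr_ge0 _)).
  + by apply: measurable_funTS; exact: measurable_inner_energy_integrand.
  + exact: sqr_ge0.
- by move=> x _; exact: inner_energy_ge0.
- by apply: measurable_funTS; exact: measurable_inner_energy.
- exact: sqr_ge0.
Qed.

Lemma moment_scale U w a p : measurable U -> measurable_fun setT w ->
  (moment mu p U (fun x => a * w x)%R = (`|a| `^ p)%:E * moment mu p U w)%E.
Proof.
move=> mU mw; rewrite /moment -ge0_integralZl_EFin ?powR_ge0//.
- by apply: eq_integral => x _; rewrite normrM powRM// EFinM.
- exact: measurable_moment.
Qed.

(** Under the normalization of energy by mass, integrating the pointwise bound [C * (1 + G)] over
    [U] gives at most [2 * C * m]. The constant is chosen before [U], [k] and [m], which is what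
    makes it uniform under contraction. *)
Lemma moment_iter_step j : exists2 C : R, 0 < C &
  forall U k m w, sobolev_kernel mu c N s m U k -> measurable_fun setT w ->
    (moment mu 2 U w <= (3 / c * m)%:E)%E -> (energy mu U k w <= m%:E)%E ->
    (moment mu (expo j) U w <= (C * m)%:E)%E.
Proof.
elim: j => [|j [B B0 IHj]].
  by exists (3 / c) => [|U k m w _ _ + _ //]; rewrite divr_gt0.
have p0 : 0 < (expo j).
  elim: j {IHj} => // j IHj; rewrite /expo iterS -/(expo j) /step addr_gt0// mulr_gt0//.
  by rewrite divr_gt0// mulr_gt0.
have [C C0 Cw] := pointwise_moment_bound mu c0 N0 s0 p0 B0.
exists (2 * C) => [|U k m w sk mw w2 Ew]; first by rewrite mulr_gt0.
have [mU muU m0 mk k0 _ _] := sk.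
have wj := IHj _ _ _ _ sk mw w2 Ew.
have mG := measurable_inner_energy mu mU mk k0 mw.
have := @integral_le3 _ _ _ mu U (fun x => (`|w x| `^ expo j.+1)%:E)
  (fun=> 1%E) (inner_energy mu U k w) (fun=> 0%E) C C 0 0 m m m 0 mU muU.
move=> /(_ (measurable_moment _ mw)) /(_ (measurable_cst _)).
move=> /(_ (measurable_funTS mG)) /(_ (measurable_cst _)).
have -> : C * m + C * m + 0 * 0 - 0 * m = 2 * C * m by ring.
apply=> //; [|exact: ltW|exact: ltW| | |].
- by move=> x _; exact: inner_energy_ge0.
- move=> x Ux; rewrite mul0e !adde0 mule1.
  by have := Cw _ _ _ _ x sk mw wj Ux; rewrite muleDr ?mule1 ?fin_num_adde_defr.
- by rewrite (integral_mass 1 mU muU) mul1r.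
- by rewrite integral0.
Qed.

(** The centre is the value of [w] at a point whose inner energy is at most three times the bound
    [eta] on its average; the lower bound [sk_far] then turns that inner energy into a second moment
    about [w x]. *)
Lemma exists_center U k m w eta : sobolev_kernel mu c N s m U k ->
  measurable_fun setT w -> 0 < eta -> (energy mu U k w <= (eta * m)%:E)%E ->
  exists z : R, (moment mu 2 U (fun x => w x - z)%R <= (3 / c * (eta * m))%:E)%E.
Proof.
move=> [mU muU m0 mk k0 kfar _] mw eta0 Ew.
have [x [Ux Gx _]] : exists x, [/\ U x,
    inner_energy mu U k w x <= (3 * eta)%:E & 0 <= (3 * 1)%:E :> \bar R]%E.
  apply: (exists_le_average (mu := mu) (m := m) (f := inner_energy mu U k w)
    (g := fun=> 0%E)) => //.
  - by rewrite muU.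
  - by apply: measurable_funTS; exact: measurable_inner_energy.
  - by move=> x _; exact: inner_energy_ge0.
  - by rewrite integral0 lee_fin mul1r ltW.
exists (w x).
have mx := measurable_inner_energy_integrand x mk mw.
have D0 : 0 < m / c by rewrite divr_gt0.
apply: (@le_trans _ _ ((m / c)%:E * inner_energy mu U k w x)%E); last first.
  have -> : 3 / c * (eta * m) = m / c * (3 * eta) by ring.
  by rewrite [leRHS]EFinM lee_wpmul2l// lee_fin ltW.
rewrite /inner_energy -ge0_integralZl_EFin//; last 3 first.
- by move=> y _; rewrite lee_fin (mulr_ge0 (k0 _) (sqr_ge0 _)).
- exact: measurable_funTS.
- exact: ltW.
apply: ge0_le_integral => //.
- by apply: measurable_moment; exact: measurable_funB.
- by apply: measurable_funeM; exact: measurable_funTS.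
- move=> y Uy; rewrite -EFinM lee_fin powR_mulrn// real_normK ?num_real// mulrA.
  have [<-|/eqP xy] := eqVneq x y; first by rewrite subrr expr0n mulr0.
  rewrite -(opprB (w x)) sqrrN ler_peMl ?sqr_ge0//.
  by rewrite mulrAC [m * _]mulrC ler_pdivlMr// mul1r kfar.
Qed.

(** Multiplying [w - z] by eta^(-1/2) brings the energy below [m], where [moment_iter_step] applies;
    undoing the scaling produces the factor eta^(p/2) in the moment of order p. *)
Lemma poincare_sobolev j : exists2 C : R, 0 < C &
  forall U k m w eta, sobolev_kernel mu c N s m U k -> measurable_fun setT w ->
    0 < eta -> (energy mu U k w <= (eta * m)%:E)%E ->
    exists2 z : R,
      (moment mu 2 U (fun x => w x - z)%R <= (C * eta * m)%:E)%E &
      (moment mu (expo j) U (fun x => w x - z)%R <=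
        (C * eta `^ ((expo j) / 2) * m)%:E)%E.
Proof.
have [C C0 Cw] := moment_iter_step j.
set Q := (expo j) in Cw *.
exists (C + 3 / c) => [|U k m w eta sk mw eta0 Ew].
  by rewrite addr_gt0// divr_gt0.
have [mU muU m0 _ _ _ _] := sk.
have [z wz] := exists_center sk mw eta0 Ew; exists z.
  apply: (le_trans wz); rewrite lee_fin mulrA ler_pM2r// ler_pM2r//.
  by rewrite lerDr ltW.
pose a := (Num.sqrt eta)^-1.
have a0 : 0 < a by rewrite invr_gt0 sqrtr_gt0.
have a2 : a ^+ 2 = eta^-1 by rewrite exprVn sqr_sqrtr// ltW.
have aQ : `|a| `^ Q = (eta `^ (Q / 2))^-1.
  rewrite gtr0_norm// /a -powR12_sqrt ?ltW// -powRN -powRN -powRrM.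
  by congr (_ `^ _); ring.
have mwz : measurable_fun setT (fun x => w x - z) by exact: measurable_funB.
have := Cw U k m (fun x => a * (w x - z)) sk.
rewrite (energy_affine a z sk mw) !moment_scale// aQ a2.
rewrite (gtr0_norm a0) (powR_mulrn 2 (ltW a0)) a2.
have etaQ : 0 < eta `^ (Q / 2) by exact: powR_gt0.
rewrite !lee_pdivrMl// -!EFinM.
have -> : eta * (3 / c * m) = 3 / c * (eta * m) by ring.
move=> /(_ (measurable_funM (measurable_cst _) mwz) wz Ew) /le_trans; apply.
rewrite lee_fin mulrA ler_pM2r// mulrC ler_pM2r// lerDl ltW// divr_gt0//.
Qed.

(** The point is that [n2] enters with coefficient exactly 1, so all the loss falls on the energy.
    This comes from integrating [powR_le_quadratic] at [w / z], unless [z] is so small that the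
    energy alone controls [w]. *)
Lemma moment_le_energy j : 2 < (expo j) -> exists2 K : R, 0 < K &
  forall U k m w eta n2, sobolev_kernel mu c N s m U k ->
    measurable_fun setT w -> 0 < eta -> 0 <= n2 ->
    (energy mu U k w <= (eta * m)%:E)%E ->
    (moment mu 2 U w <= (n2 * m)%:E)%E ->
    (moment mu (expo j) U w <=
      ((n2 + K * eta) `^ ((expo j) / 2) * m)%:E)%E.
Proof.
have [C C0 Cw] := poincare_sobolev j.
set Q := (expo j) in Cw * => Q2.
have Q0 : 0 < Q / 2 by rewrite divr_gt0// (lt_trans _ Q2).
have [K1 K10 quad] := powR_le_quadratic Q2.
(* [Ka] is fitted to the case of small [z], where the moment is at most (Ka eta)^(Q/2) m; [Kb] is
   fitted to the other case, where Q/2 Kb = 2 K1 C covers the two error terms. *)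
pose Ka := (2 `^ Q * (C + 1)) `^ (Q / 2)^-1.
pose Kb := 2 * K1 * C / (Q / 2).
have Ka0 : 0 < Ka by rewrite powR_gt0// mulr_gt0 ?powR_gt0// addr_gt0.
have Kb0 : 0 < Kb by rewrite divr_gt0// !mulr_gt0.
exists (Ka + Kb) => [|U k m w eta n2 sk mw eta0 n20 Ew w2].
  exact: addr_gt0.
have [mU muU m0 _ _ _ _] := sk.
have [z wz2 wzQ] := Cw _ _ _ _ _ sk mw eta0 Ew.
have mwz : measurable_fun setT (fun x => w x - z) by exact: measurable_funB.
have [zeta|zeta] := leP (z ^+ 2) eta.
  apply: (@le_trans _ _ ((2 `^ Q * (C * eta `^ (Q / 2) * m) +
      2 `^ Q * eta `^ (Q / 2) * m + 0 * 0 - 0 * m)%:E)).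
    apply: (@integral_le3 _ _ _ mu U _ (fun x => (`|w x - z| `^ Q)%:E)
      (fun=> 1%E) (fun=> 0%E)) => //; try exact: measurable_moment;
      try by rewrite ?mulr_ge0 ?powR_ge0.
    - move=> x Ux; rewrite mul0e !adde0 mule1 -EFinM -EFinD lee_fin -mulrDr.
      have zQ : `|z| `^ Q <= eta `^ (Q / 2).
        have -> : `|z| `^ Q = (z ^+ 2) `^ (Q / 2).
          rewrite -(real_normK (num_real z)) -powR_mulrn// -powRrM.
          by congr (_ `^ _); field.
        by rewrite ge0_ler_powR ?nnegrE ?sqr_ge0 ?(ltW Q0) ?(ltW eta0).
      apply: le_trans (ler_wpM2l (powR_ge0 _ _) (lerD (lexx _) zQ)).
      have tri : `|w x| <= `|w x - z| + `|z|.
        by rewrite -{1}(subrK z (w x)) ler_normD.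
      have Qge0 : 0 <= Q by rewrite ltW// (lt_trans _ Q2).
      have [le|le] := leP `|w x - z| `|z|.
        apply: (@le_trans _ _ (2 `^ Q * `|z| `^ Q)).
          rewrite -powRM// ge0_ler_powR ?nnegrE ?mulr_ge0//.
          by rewrite (le_trans tri)//; lra.
        by rewrite ler_wpM2l ?powR_ge0// lerDr powR_ge0.
      apply: (@le_trans _ _ (2 `^ Q * `|w x - z| `^ Q)).
        rewrite -powRM// ge0_ler_powR ?nnegrE ?mulr_ge0//.
        by rewrite (le_trans tri)//; lra.
      by rewrite ler_wpM2l ?powR_ge0// lerDl powR_ge0.
    - by rewrite (integral_mass 1 mU muU) mul1r.
    - by rewrite integral0.
  rewrite lee_fin mulr0 mul0r subr0 addr0.
  have -> : 2 `^ Q * (C * eta `^ (Q / 2) * m) + 2 `^ Q * eta `^ (Q / 2) * m =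
      (Ka * eta) `^ (Q / 2) * m.
    rewrite powRM ?(ltW Ka0) ?(ltW eta0)// /Ka -[in RHS]powRrM mulVf ?gt_eqF//.
    rewrite powRr1; first by ring.
    by rewrite mulr_ge0 ?powR_ge0// addr_ge0// ltW.
  rewrite ler_pM2r// ge0_ler_powR ?nnegrE ?(ltW Q0)//.
  - by rewrite mulr_ge0// ltW.
  - by rewrite addr_ge0// mulr_ge0 ?addr_ge0// ltW.
  - by rewrite ler_wpDl// ler_pM2r// lerDl ltW.
have z2 : 0 < z ^+ 2 by exact: lt_trans zeta.
have z0 : z != 0 by rewrite -sqrf_eq0 gt_eqF.
pose Z := (z ^+ 2) `^ (Q / 2).
have Z0 : 0 < Z by exact: powR_gt0.
have ZE : `|z| `^ Q = Z.
  rewrite /Z -(real_normK (num_real z)) -powR_mulrn// -powRrM.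
  by congr (_ `^ _); field.
have wzV y : `|y / z| `^ Q = `|y| `^ Q / Z.
  rewrite normrM powRM// normfV -ZE; congr (_ * _).
  by rewrite -(powR_inv1 (normr_ge0 z)) -powRrM mulN1r powRN.
(* [- b] is the constant term of the quadratic bound multiplied by |z|^Q; it is negative as Q >
   2. *)
pose b := Z * (Q / 2 - 1).
apply: (@le_trans _ _ ((Q / 2 * Z / z ^+ 2 * (n2 * m) +
    K1 * Z / z ^+ 2 * (C * eta * m) + K1 * (C * eta `^ (Q / 2) * m) -
    b * m)%:E)).
  apply: (@integral_le3 _ _ _ mu U _ (fun x => (`|w x| `^ 2)%:E)
      (fun x => (`|w x - z| `^ 2)%:E) (fun x => (`|w x - z| `^ Q)%:E)) => //;
    try exact: measurable_moment;
    try by move=> x _; rewrite lee_fin powR_ge0.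
  - by rewrite ltW// divr_gt0// mulr_gt0.
  - by rewrite ltW// divr_gt0// mulr_gt0.
  - exact: ltW.
  - by rewrite mulr_ge0 ?(ltW Z0)//; lra.
  move=> x _; rewrite -!EFinM -!EFinD lee_fin.
  rewrite !powR_mulrn// !real_normK ?num_real//.
  have := quad (w x / z).
  have -> : w x / z - 1 = (w x - z) / z by field.
  rewrite !wzV ler_pdivrMr// => le.
  rewrite -lerBrDr (le_trans le)// le_eqVlt; apply/orP; left; apply/eqP.
  by rewrite /b; field; rewrite z0 gt_eqF.
rewrite lee_fin.
pose v := eta / z ^+ 2.
have v0 : 0 < v by rewrite divr_gt0.
have v1 : v <= 1 by rewrite ler_pdivrMr// mul1r ltW.
have etaE : eta = v * z ^+ 2 by rewrite divfK ?gt_eqF.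
have -> : n2 + (Ka + Kb) * eta = z ^+ 2 * (n2 / z ^+ 2 + (Ka + Kb) * v).
  by rewrite etaE; field.
have y0 : 0 <= n2 / z ^+ 2 + (Ka + Kb) * v.
  apply: addr_ge0; first by rewrite divr_ge0// ltW.
  by rewrite ltW// mulr_gt0// addr_gt0.
rewrite powRM ?(ltW z2)// -/Z.
have Q1 : 1 <= Q / 2 by lra.
(* By Bernoulli it suffices to stay below the tangent at 1 of the target power, which is linear in
   [n2] and [v] like the integrated bound. *)
apply: (@le_trans _ _ (Z * (1 + Q / 2 * (n2 / z ^+ 2 + (Ka + Kb) * v - 1)) * m));
  last by rewrite ler_pM2r// ler_pM2l// bernoulli_powR.
(* Here [v <= 1] and [Q / 2 >= 1] give v^(Q/2) <= v. *)
have vQ : eta `^ (Q / 2) <= Z * v.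
  rewrite etaE powRM ?(ltW z2) ?(ltW v0)// -/Z mulrC ler_pM2l//.
  by rewrite ge1r_powR// v0.
have -> : Q / 2 * Z / z ^+ 2 * (n2 * m) + K1 * Z / z ^+ 2 * (C * eta * m) +
    K1 * (C * eta `^ (Q / 2) * m) - b * m =
    (Q / 2 * Z * (n2 / z ^+ 2) + K1 * Z * C * v + K1 * C * eta `^ (Q / 2) - b) * m.
  by rewrite /v; field.
rewrite ler_pM2r//.
have KC0 : 0 < K1 * C by exact: mulr_gt0.
have := ler_wpM2l (ltW KC0) vQ.
have -> : Z * (1 + Q / 2 * (n2 / z ^+ 2 + (Ka + Kb) * v - 1)) =
    Q / 2 * Z * (n2 / z ^+ 2) + 2 * K1 * C * Z * v + Q / 2 * Z * Ka * v - b.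
  by rewrite /b /Kb; field; rewrite z0 gt_eqF//; lra.
have : 0 < Q / 2 * Z * Ka * v by rewrite mulr_gt0// mulr_gt0// mulr_gt0.
lra.
Qed.

(** Jensen's inequality for the concave power q / Q: integrate its tangent line at 1, taken in the
    variable |w|^Q / L^(Q/2). *)
Lemma moment_jensen U m w q Q L : measurable U -> mu U = m%:E ->
  measurable_fun setT w -> 0 < q <= Q -> 0 < L ->
  (moment mu Q U w <= (L `^ (Q / 2) * m)%:E)%E ->
  (moment mu q U w <= (L `^ (q / 2) * m)%:E)%E.
Proof.
move=> mU muU mw /andP[q0 qQ] L0 wQ; have Q0 : 0 < Q := lt_le_trans q0 qQ.
have LQ : 0 < L `^ (Q / 2) by exact: powR_gt0.
have Lq : 0 < L `^ (q / 2) by exact: powR_gt0.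
have qQ1 : q / Q <= 1 by rewrite ler_pdivrMr// mul1r.
pose a1 := L `^ (q / 2) * (q / Q) / L `^ (Q / 2).
pose a2 := L `^ (q / 2) * (1 - q / Q).
apply: (@le_trans _ _ ((a1 * (L `^ (Q / 2) * m) + a2 * m + 0 * 0 - 0 * m)%:E)).
  apply: (@integral_le3 _ _ _ mu U _ (fun x => (`|w x| `^ Q)%:E)
    (fun=> 1%E) (fun=> 0%E)) => //; try exact: measurable_moment;
    try by move=> x _; rewrite lee_fin powR_ge0.
  - by rewrite ltW// divr_gt0// mulr_gt0// divr_gt0.
  - by rewrite mulr_ge0 ?subr_ge0// ltW.
  - move=> x _; rewrite mul0e !adde0 mule1 -EFinM -EFinD lee_fin.
    have qQ01 : 0 < q / Q <= 1 by rewrite divr_gt0.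
    have wL0 : 0 <= `|w x| `^ Q / L `^ (Q / 2) by rewrite divr_ge0 ?powR_ge0.
    have := bernoulli_powR_le1 qQ01 wL0.
    rewrite powRM ?powR_ge0 ?invr_ge0 ?powR_ge0// -powRrM mulrCA mulfV ?gt_eqF//.
    rewrite mulr1.
    rewrite -powRN -powRrM (_ : - (Q / 2) * (q / Q) = - (q / 2)); last first.
      by field; rewrite gt_eqF.
    rewrite !powRN ler_pdivrMr// => /le_trans; apply.
    rewrite /a1 /a2 le_eqVlt; apply/orP; left; apply/eqP; field.
    by rewrite !gt_eqF.
  - by rewrite (integral_mass 1 mU muU) mul1r.
  - by rewrite integral0.
rewrite lee_fin /a1 /a2 le_eqVlt; apply/orP; left; apply/eqP; field.
by rewrite !gt_eqF.
Qed.

Lemma subcritical_moment_le q : 0 < q ->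
  (2 * s < N -> q < 2 * N / (N - 2 * s)) -> exists2 K : R, 0 < K &
  forall U k m w eta n2, sobolev_kernel mu c N s m U k ->
    measurable_fun setT w -> 0 < eta -> 0 <= n2 ->
    (energy mu U k w <= (eta * m)%:E)%E ->
    (moment mu 2 U w <= (n2 * m)%:E)%E ->
    (moment mu q U w <= ((n2 + K * eta) `^ (q / 2) * m)%:E)%E.
Proof.
move=> q0 qcrit; pose th := 2 * s / N.
have th0 : 0 < th by rewrite divr_gt0// mulr_gt0.
(* Exceeding [2 + th] guarantees an exponent above 2; this value is itself subcritical, as (2 + th)
   (1 - th) < 2. *)
have [j qj] : exists j, Num.max q (2 + th) <= (expo j).
  apply: le_iter_affine => // th1; rewrite gt_max; apply/andP; split.
    have sN : 2 * s < N by move: th1; rewrite ltr_pdivrMr// mul1r.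
    rewrite (_ : 2 / _ = 2 * N / (N - 2 * s)) ?qcrit//.
    by rewrite /th; field; rewrite !gt_eqF// subr_gt0.
  rewrite -/th in th1 *; clearbody th; rewrite ltr_pdivlMr ?subr_gt0//.
  by have := mulr_gt0 th0 th0; lra.
move: qj; rewrite ge_max => /andP[qj thj].
have [|K K0 Kw] := @moment_le_energy j; first by apply: lt_le_trans thj; lra.
exists K => // U k m w eta n2 sk mw eta0 n20 Ew w2.
have [mU muU _ _ _ _ _] := sk.
apply: (@moment_jensen _ _ _ _ (expo j)) => //; first by rewrite q0.
- by rewrite ltr_wpDl// mulr_gt0.
- exact: (Kw _ _ _ _ _ _ sk).
Qed.

(** Some [x] in [U] has zero inner energy, since [U] is not null; positivity of the kernel off the
    diagonal then forces [w = w x] almost everywhere on [U]. *)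
Lemma energy_eq0 U k m w : sobolev_kernel mu c N s m U k ->
  measurable_fun setT w -> energy mu U k w = 0%E ->
  exists z : R, {ae mu, forall x, U x -> w x = z}.
Proof.
move=> [mU muU m0 mk k0 kfar _] mw E0.
have mG := measurable_inner_energy mu mU mk k0 mw.
have [x Ux Gx] : exists2 x, U x & inner_energy mu U k w x = 0%E.
  apply: contrapT => nex.
  have /(ae_eq_integral_abs _ mU (measurable_funTS mG)) [Z [mZ Z0 UZ]] :
      (\int[mu]_(x in U) `|inner_energy mu U k w x| = 0)%E.
    rewrite -[RHS]E0; apply: eq_integral => x _.
    by rewrite gee0_abs// inner_energy_ge0.
  have : (mu U <= mu Z)%E.
    rewrite le_measure ?inE// => x Ux; apply: UZ => /(_ Ux) Gx0.
    by apply: nex; exists x.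
  by rewrite muU Z0 lee_fin leNgt m0.
have mx := measurable_inner_energy_integrand x mk mw.
have : (\int[mu]_(y in U) `|(k (x, y) * (w x - w y) ^+ 2)%:E| = 0)%E.
  rewrite -[RHS]Gx; apply: eq_integral => y _.
  by rewrite gee0_abs// lee_fin (mulr_ge0 (k0 _) (sqr_ge0 _)).
move=> /(ae_eq_integral_abs _ mU (measurable_funTS mx)) kw0; exists (w x).
apply: filterS kw0 => y kwy Uy; have [->//|/eqP xy] := eqVneq x y.
have k_gt0 : 0 < k (x, y) by rewrite -(pmulr_lgt0 _ m0) (lt_le_trans c0)// kfar.
have /eqP := kwy Uy; rewrite eqe mulf_eq0 (gt_eqF k_gt0) sqrf_eq0 subr_eq0.
by move=> /eqP.
Qed.

End poincare_sobolev.

(** * Cubes inside a smooth domain *)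

Section row_vectors.
Context {R : realType}.
Implicit Types (n : nat).

Lemma nbhs_rVP n (x0 : 'rV[R]_n) (P : 'rV[R]_n -> Prop) :
  (\forall x \near x0, P x) <->
  exists2 r : R, 0 < r & forall x : 'rV[R]_n, (forall j, `|x 0 j - x0 0 j| < r) -> P x.
Proof.
split=> [/nbhs_ballP[r r0 rP]|[r r0 rP]].
  exists r => // x xr; apply: rP; split=> // i j.
  by rewrite (ord1 i) /ball/= distrC.
apply/nbhs_ballP; exists r => // x [_ xr]; apply: rP => j.
by have := xr 0 j; rewrite /ball/= distrC.
Qed.

Lemma measurable_box n (A : 'I_n -> set (measurableTypeR R)) :
  (forall j, measurable (A j)) ->
  measurable [set x : 'rV[R]_n | forall j, A j (x 0 j)].
Proof.
move=> mA; rewrite [X in measurable X](_ : _ = \bigcap_(j in [set: 'I_n])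
    ((fun x : 'rV[R]_n => x 0 j) @^-1` A j)).
  apply: fin_bigcap_measurable => // j _.
  by rewrite -[X in measurable X]setTI; exact: measurable_coord.
by apply/seteqP; split=> [x Ax j _|x Ax j]; exact: Ax.
Qed.

(** The sigma-algebra is generated by the coordinates, so [U] is written as the countable union of
    the cubes inside it with rational centre and radius 1 / (k + 1). *)
Lemma measurable_open_rV n (U : set 'rV[R]_n) : open U -> measurable U.
Proof.
move=> oU.
pose cube (p : 'rV[rat]_n * nat) : set 'rV[R]_n :=
  [set x | forall j, `|x 0 j - ratr (p.1 0 j)| < p.2.+1%:R^-1].
pose F p := if `[< cube p `<=` U >] then cube p else set0.
have mcube p : measurable (cube p).
  apply: (measurable_box (A := fun j => [set y | `|y - ratr (p.1 0 j)| < p.2.+1%:R^-1])).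
  move=> j; rewrite (_ : [set y | _] = ball (ratr (p.1 0 j) : R) p.2.+1%:R^-1).
    exact: measurable_ball.
  by apply/seteqP; split=> y; rewrite /ball/= distrC.
rewrite (_ : U = \bigcup_p F p).
  apply: countable_bigcupT_measurable => // p.
  by rewrite /F; case: asboolP.
apply/seteqP; split=> [x Ux|x [p _]]; last first.
  by rewrite /F; case: asboolP => // pU /pU.
have /nbhs_rVP[r r0 rU] : nbhs x U by exact: open_nbhs_nbhs.
pose k := Num.truncn (2 / r).
have kr : k.+1%:R^-1 < r / 2.
  by rewrite -[ltRHS]invf_div ltf_pV2 ?posrE ?divr_gt0 ?ltr0n// truncnS_gt.
have k0 : 0 < k.+1%:R^-1 :> R by rewrite invr_gt0 ltr0n.
have [e eE] : exists e : R, e = k.+1%:R^-1 by exists k.+1%:R^-1.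
rewrite -eE in kr k0.
have /choice[g gP] (j : 'I_n) : exists a : rat, `|x 0 j - ratr a| < e.
  have xe : x 0 j - e < x 0 j + e by lra.
  have [a] := rat_in_itvoo xe.
  by rewrite in_itv/= => /andP[? ?]; exists a; rewrite ltr_norml; lra.
exists (\row_j g j, k) => //; rewrite /F asboolT => [j|y cy] /=.
  by rewrite mxE -eE.
apply: rU => j; have := cy j; rewrite /= mxE -eE => cyj; have := gP j => gj.
rewrite (_ : _ - _ = (y 0 j - ratr (g j)) - (x 0 j - ratr (g j))); last by ring.
by rewrite (le_lt_trans (ler_normB _ _))//; lra.
Qed.

Lemma is_derive_line n (f : 'rV[R]_n -> R) (x v : 'rV[R]_n) (t : R) :
  derivable f (x + t *: v) v ->
  is_derive t 1 (fun t => f (x + t *: v)) ('D_v f (x + t *: v)).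
Proof.
have E : (fun h : R => h^-1 *: (((fun t : R => f (x + t *: v)) \o shift t)
      (h *: 1) - f (x + t *: v))) =
    (fun h : R => h^-1 *: ((f \o shift (x + t *: v)) (h *: v) - f (x + t *: v))).
  apply/funext => h /=; congr (_ *: (f _ - _)).
  by rewrite scalerDl /GRing.scale/= mulr1 addrCA addrA.
by move=> df; split; rewrite /derivable /derive E.
Qed.

(* Only one coordinate varies at a time, so the mean value theorem on lines
   parallel to the axes suffices; no total differentiability is needed. *)
Lemma smooth_locally_lipschitz n (f : 'rV[R]_n -> R) (x0 : 'rV[R]_n) :
  smooth f -> exists L r : R, [/\ 0 < L, 0 < r & forall (x y : 'rV[R]_n) d, 0 <= d ->
    (forall j, `|x 0 j - x0 0 j| < r) -> (forall j, `|y 0 j - x0 0 j| < r) ->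
    (forall j, `|y 0 j - x 0 j| <= d) -> f y - f x <= L * d].
Proof.
move=> sf.
(* By continuity [M] bounds every partial derivative near [x0]. *)
pose M := \sum_j `|partial_derive j f x0| + 1.
have M0 : 0 < M by rewrite ltr_wpDl// sumr_ge0.
have /nbhs_rVP[r r0 rM] :
    \forall x \near x0, forall j, `|partial_derive j f x| <= M.
  have := @filter_forall _ _ (fun j x => `|partial_derive j f x| <= M) (nbhs x0).
  apply=> j; have [cj _] := sf [:: j].
  apply: (@cvgr_norm_le R R _ (nbhs x0) _ (partial_derive j f) _ (cj x0) M).
  rewrite /M (bigD1 j)//= -addrA ltrDl ltr_wpDl//; exact: sumr_ge0.
exists (n%:R * M + 1), r; split=> [||x y d d0 xr yr yxd] //.
  by rewrite ltr_wpDl// mulr_ge0 ?ler0n// ltW.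
(* A path from [x] to [y] that replaces one coordinate at a time; it stays in the box around
   [x0]. *)
pose z (k : nat) : 'rV[R]_n := \row_j if (j < k)%N then y 0 j else x 0 j.
have line (a : 'rV[R]_n) j (t u : R) : t <= u ->
    (forall v, t <= v <= u -> forall i, `|(a + v *: delta_mx 0 j) 0 i - x0 0 i| < r) ->
    `|f (a + u *: delta_mx 0 j) - f (a + t *: delta_mx 0 j)| <= M * (u - t).
  move=> tu ar.
  have dF (v : R) : is_derive v 1 (fun t => f (a + t *: delta_mx 0 j))
      (partial_derive j f (a + v *: delta_mx 0 j)).
    by apply: is_derive_line; have [_ /(_ j)] := sf [::]; exact.
  have [|c ctu ->] := @MVT_segment R _ _ t u tu (fun v _ => dF v).
    apply: continuous_subspaceT => v.
    apply: differentiable_continuous; apply/derivable1_diffP.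
    exact: ex_derive.
  rewrite normrM (ger0_norm (_ : 0 <= u - t)) ?subr_ge0// ler_wpM2r ?subr_ge0//.
  by apply: rM; apply: ar; move: ctu; rewrite in_itv.
have zS k (kn : (k < n)%N) : f (z k.+1) - f (z k) <= M * d.
  pose j := Ordinal kn; pose h := y 0 j - x 0 j.
  have zE : z k.+1 = z k + h *: delta_mx 0 j.
    apply/rowP => i; rewrite !mxE eqxx/= ltnS leq_eqVlt.
    have [ij|ij] := eqVneq i j; first by rewrite ij /= eqxx ltnn /h; ring.
    rewrite (_ : (i == k :> nat) = false) ?mulr0 ?addr0//.
    by apply/negbTE; apply: contraNneq ij => ik; apply/eqP/val_inj.
  have hd : `|h| <= d by exact: yxd.
  have inr v : (v = 0 \/ (0 <= v <= h) \/ (h <= v <= 0)) ->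
      forall i, `|(z k + v *: delta_mx 0 j) 0 i - x0 0 i| < r.
    move=> vh i; rewrite !mxE eqxx/=.
    have [->|ij] := eqVneq i j.
      rewrite /= ltnn mulr1; have := xr j; have := yr j; move: vh; rewrite /h.
      rewrite !ltr_norml => vh /andP[? ?] /andP[? ?]; apply/andP.
      by case: vh => [->|[/andP[? ?]|/andP[? ?]]]; split; lra.
    by rewrite mulr0 addr0; case: ifP.
  apply: (le_trans (ler_norm _)); rewrite zE.
  have -> : f (z k) = f (z k + 0 *: delta_mx 0 j) by rewrite scale0r addr0.
  apply: (@le_trans _ _ (M * `|h|)); last by rewrite ler_pM2l.
  have [h0|h0] := leP 0 h.
    rewrite (le_trans (line _ _ _ _ h0 _))// ?subr0 ?ger0_norm//.
    by move=> v vh; apply: inr; right; left.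
  rewrite distrC (le_trans (line _ _ _ _ (ltW h0) _))//.
    by move=> v vh; apply: inr; right; right.
  by rewrite sub0r ltr0_norm.
have fz k : (k <= n)%N -> f (z k) - f (z 0%N) <= k%:R * (M * d).
  elim: k => [|k IHk] kn; first by rewrite subrr mul0r.
  have := zS k kn; have := IHk (ltnW kn); rewrite -[k.+1%:R]natr1; lra.
have z0 : z 0%N = x by apply/rowP => j; rewrite mxE.
have zn : z n = y by apply/rowP => j; rewrite mxE ltn_ord.
have := fz n (leqnn n); rewrite z0 zn => /le_trans; apply.
by rewrite mulrA ler_wpM2r// lerDl.
Qed.

End row_vectors.

(** * Interior cubes at every small scale *)

Section inner_cubes.
Context {R : realType} {n : nat}.
Implicit Types (U Omega : set 'rV[R]_n) (x y z : 'rV[R]_n) (d e l r : R).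

Definition cube_near U x l r : Prop := exists z, forall y,
  (forall j, z 0 j < y 0 j < z 0 j + l) ->
  U y /\ forall j, `|y 0 j - x 0 j| < r.

Lemma cube_nearS U x l1 l2 r :
  l1 <= l2 -> cube_near U x l2 r -> cube_near U x l1 r.
Proof.
move=> l12 [z zU]; exists z => y yz; apply: zU => j.
by have /andP[-> /lt_le_trans] := yz j; apply; rewrite lerD2l.
Qed.

Lemma interior_cubes U x0 : nbhs x0 U -> exists d rho, [/\ 0 < d, 0 < rho &
  forall x r, (forall j, `|x 0 j - x0 0 j| < rho) -> 0 < r <= d ->
    cube_near U x (d * r) r].
Proof.
move=> /nbhs_rVP[e e0 eU].
exists (Num.min (e / 2) 1), (e / 2); split.
- by rewrite lt_min divr_gt0//= ltr01.
- by rewrite divr_gt0.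
move=> x r xe /andP[r0]; rewrite le_min => /andP[re r1].
apply: (@cube_nearS _ _ _ r); first by rewrite ler_piMl ?ge_min ?lexx ?orbT// ltW.
exists x => y yx; have yr j : `|y 0 j - x 0 j| < r.
  by have := yx j; rewrite ltr_norml => /andP[? ?]; lra.
split=> //; apply: eU => j; have := yr j; have := xe j.
by rewrite !ltr_norml => /andP[? ?] /andP[? ?]; lra.
Qed.

(* Above the graph of an [L]-Lipschitz function, a cube of side [d * r] with
   [L * d <= 1 / 2] fits at height between [r / 2] and [r] over any point. *)
Lemma boundary_cubes Omega x0 : smooth_boundary Omega -> boundary Omega x0 ->
  exists d rho, [/\ 0 < d, 0 < rho & forall x r, Omega x ->
    (forall j, `|x 0 j - x0 0 j| < rho) -> 0 < r <= d ->
    cube_near Omega x (d * r) r].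
Proof.
move=> sO /sO[i [b [g [sg /nbhs_rVP[r1 r10 Or1]]]]].
have [L [r2 [L0 r20 gL]]] := smooth_locally_lipschitz (col' i x0) sg.
pose rho := Num.min r1 r2.
have rho0 : 0 < rho by rewrite lt_min r10.
have [rr1 rr2] : rho <= r1 /\ rho <= r2 by rewrite !ge_min !lexx orbT.
(* In order: the cube stays in the chart, it stays within [r] of [x], and the graph rises by at most
   [r / 2] across it. *)
pose d := Num.min (rho / 2) (Num.min (4^-1) (2 * L)^-1).
have L2 : 0 < (2 * L)^-1 by rewrite invr_gt0 mulr_gt0.
have d0 : 0 < d by rewrite !lt_min divr_gt0//= L2 andbT.
have [d1 d2 d3] : [/\ d <= rho / 2, d <= 4^-1 & d <= (2 * L)^-1].
  by rewrite !ge_min !lexx !orbT.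
have Ld : L * d <= 2^-1.
  rewrite (le_trans (ler_wpM2l (ltW L0) d3))// invfM mulrCA mulfV ?gt_eqF//.
  by rewrite mulr1.
clearbody d rho; exists d, (rho / 2); split=> //; first by rewrite divr_gt0.
move=> x r Ox xx0 /andP[r0 rd].
have xr1 j : `|x 0 j - x0 0 j| < r1.
  by rewrite (lt_le_trans (xx0 j))//; lra.
have dr : 0 < d * r by exact: mulr_gt0.
have dr4 : d * r <= r / 4 by rewrite mulrC ler_pM2l.
have Ldr : L * (d * r) <= r / 2 by rewrite mulrA mulrC ler_pM2l.
(* The shift goes into the domain; when [b] holds the domain lies below the graph, and the lower
   corner moves down by the side of the cube as well. *)
pose z := \row_j if j == i then
  x 0 i + (if b then - (r / 2) - d * r else r / 2) else x 0 j.
exists z => y yz.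
have yi : (-1) ^+ b * x 0 i + r / 2 < (-1) ^+ b * y 0 i.
  by have := yz i; rewrite mxE eqxx; case: (b) => /andP[? ?] /=; lra.
have yxj j : j != i -> `|y 0 j - x 0 j| <= d * r.
  move=> ji; have := yz j; rewrite mxE (negbTE ji) => /andP[? ?].
  by rewrite ler_norml; lra.
have yx j : `|y 0 j - x 0 j| < r.
  have [->|/yxj /le_lt_trans->//] := eqVneq j i; last lra.
  have := yz i; rewrite mxE eqxx ltr_norml.
  by case: (b) => /andP[? ?] /=; lra.
have yx0 j : `|y 0 j - x0 0 j| < rho.
  have := yx j; have := xx0 j.
  by rewrite !ltr_norml => /andP[? ?] /andP[? ?]; lra.
split=> //; apply/Or1 => [j|]; first by rewrite (lt_le_trans (yx0 j)).
have gx := (iffLR (Or1 x xr1)) Ox.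
have : g (col' i y) - g (col' i x) <= L * (d * r).
  apply: gL => [|j|j|j]; rewrite ?mxE.
  - exact: ltW.
  - by rewrite (lt_le_trans (xx0 _))//; lra.
  - by rewrite (lt_le_trans (yx0 _)).
  - by rewrite yxj// eq_sym neq_lift.
lra.
Qed.

Lemma bounded_set_coord Omega : bounded_set Omega ->
  exists2 D : R, 0 < D & forall x j, Omega x -> `|x 0 j| < D.
Proof.
move=> [M [_ OM]]; exists (`|M| + 2); first by rewrite ltr_wpDl.
move=> x j Ox; have M1 : M < `|M| + 1 by rewrite ltr_pwDr// ler_norm.
apply: (@le_lt_trans _ _ (`|M| + 1)); last by rewrite ltrD2l ltr1n.
apply: le_trans (OM _ M1 _ Ox).
by rewrite [leRHS]/Num.Def.normr/= mx_normrE; apply/bigmax_geP; right; exists (0, j).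
Qed.

(** The local constants become uniform by compactness of a closed box containing [Omega]. The
    property [P d] only weakens as [d] decreases, so it can be phrased along the filter of positive
    [d] tending to 0. *)
Lemma domain_cubes Omega : open Omega -> bounded_set Omega ->
  smooth_boundary Omega -> exists2 d : R, 0 < d &
    forall x r, Omega x -> 0 < r <= d -> cube_near Omega x (d * r) r.
Proof.
move=> oO /bounded_set_coord[D _ OD] sO.
pose K := [set x : 'rV[R]_n | forall j, x 0 j \in `[- D, D]].
have OK : Omega `<=` K by move=> x Ox j; rewrite in_itv/= -ler_norml ltW ?OD.
have cK : compact K.
  apply: (@rV_compact _ _ (fun=> [set` `[- D, D]])) => _.
  exact: segment_compact.
pose P (d : R) x := Omega x -> forall r, 0 < r <= d -> cube_near Omega x (d * r) r.
have Pnear x : (exists d rho, [/\ 0 < d, 0 < rho & forall y r, Omega y ->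
      (forall j, `|y 0 j - x 0 j| < rho) -> 0 < r <= d ->
      cube_near Omega y (d * r) r]) ->
    \forall y \near x & d \near 0^'+, P d y.
  move=> [d [rho [d0 rho0 dP]]].
  exists ([set y : 'rV[R]_n | forall j, `|y 0 j - x 0 j| < rho], [set e : R | 0 < e <= d]).
    split; first by apply/nbhs_rVP; exists rho.
    by near=> e; apply/andP; split; near: e; [exact: nbhs_right_gt|
      exact: nbhs_right_le].
  move=> [y e] /= [yx /andP[e0 ed]] Oy r /andP[r0 re].
  apply: (@cube_nearS _ _ _ (d * r)); first by rewrite ler_pM2r.
  by apply: dP => //; rewrite r0 (le_trans re).
have := (iffLR (compact_near_coveringP K)) cK R (0^'+) P _.
move=> /(_ (at_right_proper_filter _))/(_ _)/wrap[x _|KP].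
  apply: Pnear.
  have [xi|xi] := pselect (nbhs x Omega).
    have [d [rho [d0 rho0 dP]]] := interior_cubes xi.
    by exists d, rho; split=> // y r _; exact: dP.
  have [xc|xc] := pselect (closure Omega x).
    by apply: boundary_cubes => //; split.
  have : nbhs x (~` Omega).
    apply: contrapT => nx; apply: xc => B /nbhs_rVP[r r0 rB].
    apply: contrapT => OB; apply: nx; apply/nbhs_rVP; exists r => // y /rB By Oy.
    by apply: OB; exists y.
  (* Near an exterior point the claim is vacuous. *)
  move=> /nbhs_rVP[r r0 rO]; exists 1, r; split=> // y ? Oy /rO.
  by [].
near (0 : R)^'+ => d; exists d => // x r Ox rd.
have /(_ x (OK _ Ox) Ox r rd) : K `<=` P d by near: d.
by [].
Unshelve. all: by end_near. Qed.

End inner_cubes.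

(** * The Sobolev quotient of a contracted domain *)

Section contracted_kernel.
Context {R : realType} {n : nat}.
Implicit Types (U Omega : set 'rV[R]_n) (x y z : 'rV[R]_n) (e d s t : R).
Let mu := @lebesgue_rV R n.
Let N : R := n%:R.

(** The Gagliardo kernel with a weight: [a = 1] gives the seminorm itself, and [a] = eps^(2 s) the
    scale-invariant energy on the contracted domain. *)
Definition riesz_kernel a s (z : 'rV[R]_n * 'rV[R]_n) : R :=
  a / (euclid_norm (z.1 - z.2)) `^ (n%:R + 2 * s).

Lemma euclid_norm_ge0 x : 0 <= euclid_norm x.
Proof. exact: sqrtr_ge0. Qed.

Lemma euclid_norm_le x b : (forall j, `|x 0 j| <= b) -> 0 <= b ->
  euclid_norm x <= n%:R * b.
Proof.
move=> xb b0; rewrite /euclid_norm -[leRHS]ger0_norm ?mulr_ge0 ?ler0n//.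
rewrite -sqrtr_sqr ler_wsqrtr//.
apply: (@le_trans _ _ (\sum_(i < n) b ^+ 2)).
  apply: ler_sum => i _; rewrite -(real_normK (num_real _)).
  by rewrite lerXn2r ?nnegrE.
rewrite sumr_const card_ord -[leLHS]mulr_natl exprMn ler_wpM2r ?sqr_ge0//.
by rewrite -natrX ler_nat; case: (n) => // k; rewrite expnS leq_pmulr ?expn_gt0.
Qed.

Lemma euclid_norm_gt0 x : x <> 0 -> 0 < euclid_norm x.
Proof.
move=> x0; rewrite sqrtr_gt0 lt_neqAle sumr_ge0 ?andbT => [|i _]; last first.
  exact: sqr_ge0.
apply/eqP => /esym/eqP; rewrite psumr_eq0 => [/allP xE|i _]; last exact: sqr_ge0.
apply: x0; apply/rowP => j; rewrite mxE; apply/eqP.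
by rewrite -sqrf_eq0 (eqP (xE j _)) ?mem_index_enum.
Qed.

Lemma measurable_riesz_kernel a s :
  measurable_fun [set: 'rV[R]_n * 'rV[R]_n] (riesz_kernel a s).
Proof.
rewrite (_ : riesz_kernel a s = fun p : 'rV[R]_n * 'rV[R]_n =>
    a * ((\sum_i (p.1 0 i - p.2 0 i) ^+ 2) `^ 2^-1) `^ (- (n%:R + 2 * s))).
  apply: measurable_funM => //.
  apply: (measurableT_comp (measurable_powR _)).
  apply: (measurableT_comp (measurable_powR _)).
  apply: measurable_sum => i; apply: measurable_funX; apply: measurable_funB.
    exact: (measurableT_comp (measurable_coord i) measurable_fst).
  exact: (measurableT_comp (measurable_coord i) measurable_snd).
apply/funext => p; rewrite /riesz_kernel powRN; congr (_ / _ `^ _).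
rewrite /euclid_norm powR12_sqrt; last first.
  by apply: sumr_ge0 => i _; exact: sqr_ge0.
by congr Num.sqrt; apply: eq_bigr => i _; rewrite !mxE.
Qed.

Lemma riesz_kernel_ge0 a s p : 0 <= a -> 0 <= riesz_kernel a s p.
Proof. by move=> a0; rewrite divr_ge0// powR_ge0. Qed.

Lemma riesz_kernel_ge a s b x y : (0 < n)%N -> 0 < s -> 0 <= a -> 0 < b ->
  x <> y -> (forall j, `|x 0 j - y 0 j| <= b) ->
  a / (n%:R * b) `^ (n%:R + 2 * s) <= riesz_kernel a s (x, y).
Proof.
move=> n0 s0 a0 b0 xy xyb; rewrite /riesz_kernel ler_wpM2l//=.
have Ns0 : 0 < n%:R + 2 * s by rewrite ltr_wpDl ?ler0n// mulr_gt0.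
have e0 : 0 < euclid_norm (x - y).
  by apply: euclid_norm_gt0 => /eqP; rewrite subr_eq0 => /eqP.
have nb0 : 0 < n%:R * b by rewrite mulr_gt0// ltr0n.
rewrite lef_pV2 ?posrE ?powR_gt0// ge0_ler_powR ?nnegrE ?(ltW Ns0) ?(ltW nb0)//.
  exact: euclid_norm_ge0.
by apply: euclid_norm_le; rewrite ?ltW// => j; rewrite !mxE.
Qed.

Lemma contracted_domainE e Omega : 0 < e ->
  contracted_domain e Omega = [set x | Omega (e^-1 *: x)].
Proof.
move=> e0; have e_neq0 : e != 0 by rewrite gt_eqF.
apply/seteqP; split=> [_ [x Ox <-]|x Ox] /=; first by rewrite scalerK.
by exists (e^-1 *: x) => //; rewrite scalerKV.
Qed.

Lemma measurable_contracted_domain e Omega : 0 < e -> open Omega ->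
  measurable (contracted_domain e Omega).
Proof.
move=> e0 oO; rewrite contracted_domainE//; apply: measurable_open_rV.
by apply: (open_comp _ oO) => x _; exact: scaler_continuous.
Qed.

Lemma lebesgue_rV_cube z l : 0 < l ->
  measurable [set y : 'rV[R]_n | forall j, z 0 j < y 0 j < z 0 j + l] /\
  mu [set y : 'rV[R]_n | forall j, z 0 j < y 0 j < z 0 j + l] = (l ^+ n)%:E.
Proof.
move=> l0; pose A (j : 'I_n) : set (measurableTypeR R) :=
  [set` `]z 0 j, z 0 j + l[%R].
have -> : [set y : 'rV[R]_n | forall j, z 0 j < y 0 j < z 0 j + l] =
    [set y : 'rV[R]_n | forall j, A j (y 0 j)].
  by apply/seteqP; split=> y yz j; have := yz j; rewrite /A /= in_itv.
have mA j : measurable (A j) by exact: measurable_itv.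
split; first exact: measurable_box.
rewrite /mu lebesgue_rV_box//.
under eq_bigr => j _.
  rewrite /A lebesgue_measure_itv/= lte_fin ltrDl l0 -EFinD addrAC subrr add0r.
over.
by rewrite prodEFin prodr_const card_ord.
Qed.

(** The mass [m] is comparable to e^n, while the weighted kernel at distance e b is of order e^(-n);
    all powers of [e] cancel in their product, so [c] is independent of [e]. *)
Lemma contracted_sobolev_kernel Omega s d D : (0 < n)%N -> 0 < s ->
  open Omega -> Omega !=set0 -> 0 < d -> 0 < D ->
  (forall x r, Omega x -> 0 < r <= d -> cube_near Omega x (d * r) r) ->
  (forall x j, Omega x -> `|x 0 j| < D) ->
  exists2 c : R, 0 < c & forall e, 0 < e -> exists m,
    sobolev_kernel mu c n%:R s m (contracted_domain e Omega)
      (riesz_kernel (e `^ (2 * s)) s).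
Proof.
move=> n0 s0 oO [x0 Ox0] d0 D0 dO DO.
pose Ns := N + 2 * s.
have NR0 : 0 < N by rewrite ltr0n.
have Ns0 : 0 < Ns by rewrite addr_gt0// mulr_gt0.
(* [c1] is the density of the inner cubes, [c2] serves the kernel bound at distance e d t, and [c3]
   the one across the whole domain. *)
pose c1 := (d ^+ 2 / (2 * D)) ^+ n.
pose c2 := (d ^+ 2) ^+ n / (N * d) `^ Ns.
pose c3 := (d ^+ 2) ^+ n / (N * (2 * D)) `^ Ns.
have d20 : 0 < d ^+ 2 by rewrite exprn_gt0.
have c10 : 0 < c1 by rewrite exprn_gt0// divr_gt0// mulr_gt0.
have c20 : 0 < c2 by rewrite divr_gt0 ?exprn_gt0// powR_gt0// mulr_gt0.
have c30 : 0 < c3 by rewrite divr_gt0 ?exprn_gt0// powR_gt0// !mulr_gt0.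
exists (Num.min c1 (Num.min c2 c3)); first by rewrite !lt_min c10 c20.
set c := Num.min _ _.
have [cc1 cc2 cc3] : [/\ c <= c1, c <= c2 & c <= c3].
  by rewrite !ge_min !lexx !orbT.
move=> e e0.
have e_neq0 : e != 0 by rewrite gt_eqF.
have mU := measurable_contracted_domain e0 oO.
set U := contracted_domain e Omega in mU *.
have UD x j : U x -> `|x 0 j| < e * D.
  by move=> [y Oy <-]; rewrite mxE normrM gtr0_norm// ltr_pM2l// DO.
have [m mE mle] : exists2 m, mu U = m%:E & m <= (e * (2 * D)) ^+ n.
  have l0 : 0 < e * (2 * D) by rewrite !mulr_gt0.
  have [mC muC] := lebesgue_rV_cube (const_mx (- (e * D))) l0.
  have : (mu U <= ((e * (2 * D)) ^+ n)%:E)%E.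
    rewrite -muC le_measure ?inE// => x Ux j /=; rewrite mxE.
    by have := UD x j Ux; rewrite ltr_norml => /andP[? ?]; lra.
  have : (0 <= mu U)%E by exact: measure_ge0.
  by case: (mu U) => // r _; rewrite lee_fin; exists r.
(* The cube for the preimage of [x] in [Omega] at scale [r = d * t], dilated by [e]; its side is e
   d^2 t. *)
have Ucube x t : U x -> 0 < t <= 1 -> exists A, [/\ measurable A, A `<=` U,
    mu A = ((e * (d ^+ 2 * t)) ^+ n)%:E &
    forall y, A y -> forall j, `|x 0 j - y 0 j| <= e * (d * t)].
  move=> [x' Ox' <-] /andP[t0 t1].
  have [|z zO] := dO x' (d * t) Ox'; first by rewrite mulr_gt0//= ler_piMr// ltW.
  have l0 : 0 < e * (d ^+ 2 * t) by rewrite !mulr_gt0.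
  have [mC muC] := lebesgue_rV_cube (e *: z) l0.
  have scale y : (forall j, (e *: z) 0 j < y 0 j < (e *: z) 0 j + e * (d ^+ 2 * t)) ->
      forall j, z 0 j < (e^-1 *: y) 0 j < z 0 j + d * (d * t).
    move=> yz j; have := yz j; rewrite !mxE => /andP[yl yu].
    rewrite ltr_pdivlMl// yl /= ltr_pdivrMl// (lt_le_trans yu)//.
    by rewrite mulrDr lerD2l ler_pM2l// expr2 mulrA.
  eexists; split; [exact: mC| |exact: muC|].
    by move=> y /scale/zO[Oy _]; rewrite /U contracted_domainE.
  move=> y /scale/zO[_ yx'] j; have := yx' j.
  rewrite !mxE distrC -(ltr_pM2l e0) -{1}(gtr0_norm e0) -normrM mulrBr mulVKf//.
  exact: ltW.
have mge : (e * d ^+ 2) ^+ n <= m.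
  have Ux0 : U (e *: x0) by exists x0.
  have t11 : 0 < (1 : R) <= 1 by rewrite ltr01 lexx.
  have [A [mA AU muA _]] := Ucube _ _ Ux0 t11; rewrite mulr1 in muA.
  by rewrite -lee_fin -mE -muA le_measure ?inE.
have m0 : 0 < m by rewrite (lt_le_trans _ mge)// exprn_gt0// mulr_gt0.
have kge x y b : 0 < b -> x <> y -> (forall j, `|x 0 j - y 0 j| <= e * b) ->
    (d ^+ 2) ^+ n / (N * b) `^ Ns <= riesz_kernel (e `^ (2 * s)) s (x, y) * m.
  move=> b0 xy xyb.
  have := riesz_kernel_ge n0 s0 (powR_ge0 e (2 * s)) (mulr_gt0 e0 b0) xy xyb.
  rewrite -/N -/Ns => kle.
  have lhs0 : 0 <= e `^ (2 * s) / (N * (e * b)) `^ Ns by rewrite divr_ge0 ?powR_ge0.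
  have rhs0 : 0 <= (e * d ^+ 2) ^+ n by rewrite exprn_ge0// mulr_ge0// ltW.
  apply: le_trans (ler_pM lhs0 rhs0 kle mge).
  have -> : N * (e * b) = e * (N * b) by ring.
  rewrite (powRM _ (ltW e0) (ltW (mulr_gt0 NR0 b0))).
  have -> : e `^ Ns = e ^+ n * e `^ (2 * s).
    by rewrite /Ns powRD ?powR_mulrn ?(ltW e0)// (gt_eqF e0) implybT.
  have Nb0 : 0 < (N * b) `^ Ns by rewrite powR_gt0// mulr_gt0.
  rewrite le_eqVlt; apply/orP; left; apply/eqP; rewrite (exprMn n e).
  move: (exprn_gt0 n e0) (powR_gt0 (2 * s) e0) Nb0.
  move: (e ^+ n) (e `^ (2 * s)) (_ `^ Ns) ((d ^+ 2) ^+ n) => a1 a2 a3 a4 *; field.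
  by rewrite !gt_eqF.
exists m; split=> //.
- exact: measurable_riesz_kernel.
- by move=> p; rewrite riesz_kernel_ge0// powR_ge0.
- move=> x y Ux Uy xy; apply: (le_trans cc3); apply: kge => // [|j].
    by rewrite mulr_gt0.
  have := UD x j Ux; have := UD y j Uy; rewrite !ltr_norml => /andP[? ?] /andP[? ?].
  by rewrite ler_norml; apply/andP; split; lra.
- move=> x t Ux /[dup] t01 /andP[t0 t1].
  have [A [mA AU muA Ax]] := Ucube x t Ux t01; exists A; split=> //.
    rewrite muA lee_fin powR_mulrn ?(ltW t0)//.
    apply: (@le_trans _ _ (c1 * t ^+ n * (e * (2 * D)) ^+ n)).
      rewrite ler_pM ?mulr_ge0 ?exprn_ge0 ?(ltW t0) ?(ltW m0)//.
        by rewrite le_min (ltW c10) le_min (ltW c20) ltW.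
      by rewrite ler_pM2r// exprn_gt0.
    rewrite /c1 -!exprMn le_eqVlt; apply/orP; left; apply/eqP.
    by congr (_ ^+ _); field; rewrite gt_eqF.
  move=> y Ay xy; apply: (@le_trans _ _ (c2 * t `^ (- Ns))).
    by rewrite ler_pM2r// powR_gt0.
  apply: le_trans (kge _ _ _ (mulr_gt0 d0 t0) xy (Ax y Ay)).
  rewrite mulrA powRM ?mulr_ge0 ?(ltW NR0) ?(ltW d0) ?(ltW t0)// powRN /c2.
  by rewrite invfM mulrA.
Qed.

End contracted_kernel.

(** * Energy bound for the Sobolev quotient and its equality case *)

Section extremals.
Context {R : realType} {n : nat}.
Implicit Types (U : set 'rV[R]_n) (u w : 'rV[R]_n -> R) (a s q r m : R).
Let mu := @lebesgue_rV R n.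

Lemma integral_setX_tonelli U (f : 'rV[R]_n * 'rV[R]_n -> \bar R) :
  measurable U -> measurable_fun setT f -> (forall z, 0 <= f z)%E ->
  (\int[mu \x mu]_(z in U `*` U) f z =
   \int[mu]_(x in U) \int[mu]_(y in U) f (x, y))%E.
Proof.
move=> mU mf f0; rewrite integral_mkcond fubini_tonelli1; last 2 first.
- apply/(measurable_restrictT _ _).1; first exact: measurableX.
  exact: measurable_funTS.
- by move=> z; apply: erestrict_ge0.
rewrite [RHS]integral_mkcond; apply: eq_integral => x _.
rewrite patchE /fubini_F; case: ifPn => xU.
  rewrite [RHS]integral_mkcond; apply: eq_integral => y _.
  by rewrite !patchE in_setX /= xU.
rewrite -[RHS](integral0 mu setT); apply: eq_integral => y _.
by rewrite patchE in_setX /= (negbTE xU).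
Qed.

Lemma poweR_half_sqr (x : \bar R) : (0 <= x -> (x `^ 2^-1) ^+ 2 = x)%E.
Proof.
case: x => [x| |//]; rewrite ?lee_fin => x0.
  by rewrite poweR_EFin -EFin_expe powR12_sqrt// sqr_sqrtr.
by rewrite poweRyr ?invr_eq0//.
Qed.

Lemma normL_moment r U u : measurable U -> 0 < r ->
  normL r U u = (moment mu r U u `^ r^-1)%E.
Proof.
move=> mU r0; rewrite /normL unlock /moment [in RHS]integral_mkcond.
congr (_ `^ _)%E; apply: eq_integral => x _ /=.
rewrite !patchE; case: ifPn => _ //.
(* Outside [U] the restriction takes the default value 0, whose power vanishes because [r] is
   nonzero. *)
by rewrite (_ : point = 0 :> R)// normr0 powR0 ?gt_eqF.
Qed.

Lemma energy_scale a s U u : 0 <= a -> measurable U -> measurable_fun setT u ->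
  energy mu U (riesz_kernel a s) u = (a%:E * energy mu U (riesz_kernel 1 s) u)%E.
Proof.
move=> a0 mU mu_; rewrite /energy -ge0_integralZl_EFin//.
- apply: eq_integral => x _; rewrite /inner_energy -ge0_integralZl_EFin//.
  + by apply: eq_integral => y _; rewrite -EFinM /riesz_kernel mul1r !mulrA.
  + by move=> y _; rewrite lee_fin (mulr_ge0 _ (sqr_ge0 _))// riesz_kernel_ge0.
  + apply: measurable_funTS; apply: measurable_inner_energy_integrand => //.
    exact: measurable_riesz_kernel.
- by move=> x _; apply: inner_energy_ge0 => z; exact: riesz_kernel_ge0.
- apply: measurable_funTS; apply: measurable_inner_energy => // [|z].
    exact: measurable_riesz_kernel.
  exact: riesz_kernel_ge0.
Qed.

Lemma gagliardo_energy s U u w : measurable U -> measurable_fun setT w ->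
  (forall x, U x -> w x = u x) ->
  gagliardo s U u = (energy mu U (riesz_kernel 1 s) w `^ 2^-1)%E.
Proof.
move=> mU mw wu; rewrite /gagliardo /energy; congr (_ `^ _)%E.
rewrite -(@integral_setX_tonelli U (fun z =>
  (riesz_kernel 1 s z * (w z.1 - w z.2) ^+ 2)%:E))//.
- apply: eq_integral => z; rewrite in_setX => /andP[]; rewrite !inE => z1 z2.
  by rewrite !wu// /riesz_kernel div1r mulrC.
- apply: measurable_energy_integrand => //; exact: measurable_riesz_kernel.
- by move=> z; rewrite lee_fin (mulr_ge0 _ (sqr_ge0 _))// riesz_kernel_ge0.
Qed.

(** Elements of the space are measurable on [U] only, whereas the energy estimates ask for global
    measurability; extending [u] by 0 changes none of the norms. *)
Lemma H_spaceE s U u : measurable U -> H_space s U u ->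
  exists w (j a : R), [/\ measurable_fun setT w /\ (forall x, U x -> w x = u x),
    energy mu U (riesz_kernel 1 s) w = j%:E, moment mu 2 U w = a%:E,
    (normH s U u ^+ 2 = (j + a)%:E)%E &
    forall r, 0 < r -> normL r U u = (moment mu r U w `^ r^-1)%E].
Proof.
move=> mU [mu_ L2 G]; pose w := (u \_ U)%R.
have mw : measurable_fun setT w by apply/(measurable_restrictT _ _).1.
have wu x : U x -> w x = u x by move=> Ux; rewrite /w patchE mem_set.
have wr r : moment mu r U w = moment mu r U u.
  by apply: eq_integral => x; rewrite inE => Ux; rewrite wu.
have Lr r : 0 < r -> normL r U u = (moment mu r U w `^ r^-1)%E.
  by move=> r0; rewrite wr normL_moment.
have EG := gagliardo_energy s mU mw wu.
have E0 : (0 <= energy mu U (riesz_kernel 1 s) w)%E.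
  apply: integral_ge0 => x _; apply: inner_energy_ge0 => z.
  exact: riesz_kernel_ge0.
have M0 : (0 <= moment mu 2 U w)%E.
  by apply: integral_ge0 => x _; rewrite lee_fin powR_ge0.
have Eoo : (energy mu U (riesz_kernel 1 s) w < +oo)%E.
  by rewrite EG in G; apply: lty_poweRy G; rewrite invr_eq0.
have Moo : (moment mu 2 U w < +oo)%E.
  by rewrite Lr// in L2; apply: lty_poweRy L2; rewrite invr_eq0.
move: (E0) (M0) Eoo Moo; case Ej : (energy _ _ _ _) => [j| |//] //.
case Ma : (moment _ _ _ _) => [a| |//] // *.
exists w, j, a; split=> //.
rewrite /normH poweR_half_sqr ?EG ?Lr//; first by rewrite !poweR_half_sqr// Ej Ma.
by rewrite adde_ge0// -?expeS sqre_ge0.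
Qed.

Lemma sobolev_quotient_cst1 s q m U : 0 < q -> 0 < m -> measurable U ->
  mu U = m%:E -> H_space_neq0 s U (cst 1) /\
  sobolev_quotient s q U (cst 1) = (m `^ (1 - 2 / q))%:E.
Proof.
move=> q0 m0 mU muU; have m1 : measurable_fun setT (cst 1 : 'rV[R]_n -> R) by [].
have E1 : energy mu U (riesz_kernel 1 s) (cst 1) = 0%E.
  rewrite /energy integral0_eq// => x _; rewrite /inner_energy integral0_eq// => y _.
  by rewrite /= subrr expr0n mulr0.
have M1 r : moment mu r U (cst 1) = m%:E.
  rewrite -[m in RHS]mul1r -(integral_mass 1 mU muU).
  by apply: eq_integral => x _; rewrite normr1 powR1.
have G1 : gagliardo s U (cst 1) = 0%E.
  rewrite (@gagliardo_energy _ _ _ (cst 1) mU)// E1.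
  by rewrite poweR0r// invr_eq0.
have L1 r : 0 < r -> normL r U (cst 1) = (m `^ r^-1)%:E.
  by move=> r0; rewrite normL_moment// M1 poweR_EFin.
split.
  split; first by split; rewrite ?L1 ?G1 ?ltry//; exact: measurable_funTS.
  move=> [Z [mZ Z0 UZ]].
  have : (mu U <= mu Z)%E.
    rewrite le_measure ?inE// => x Ux; apply: UZ => /(_ Ux) /eqP.
    by rewrite /= oner_eq0.
  by rewrite muU Z0 lee_fin leNgt m0.
rewrite /sobolev_quotient /normH G1 !L1// poweR_half_sqr; last first.
  by rewrite -!EFin_expe -EFinD lee_fin addr_ge0// sqr_ge0.
rewrite -!EFin_expe -EFinD expr0n add0r powR12_sqrt ?sqr_sqrtr ?(ltW m0)//.
have mq : 0 < (m `^ q^-1) ^+ 2 by rewrite exprn_gt0// powR_gt0.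
have -> : m `^ (1 - 2 / q) = m / m `^ (2 / q).
  by rewrite powRB ?powRr1 ?(ltW m0)// (gt_eqF m0) implybT.
rewrite inver gt_eqF// -EFinM.
by congr (_ / _)%:E; rewrite -powR_mulrn ?powR_ge0// -powRrM mulrC.
Qed.

(** The moment bound amounts to m^(1 - 2/q) |u|_q^2 <= |u|_2^2 + K a [u]^2. As K a < 1, equality in
    the quotient leaves no seminorm, and zero energy makes [u] constant. *)
Lemma sobolev_quotient_ge c s a m q K U u : 0 < c -> 0 < a -> 0 < K -> 0 < q ->
  K * a < 1 -> sobolev_kernel mu c n%:R s m U (riesz_kernel a s) ->
  (forall w eta n2, measurable_fun setT w -> 0 < eta -> 0 <= n2 ->
    (energy mu U (riesz_kernel a s) w <= (eta * m)%:E)%E ->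
    (moment mu 2 U w <= (n2 * m)%:E)%E ->
    (moment mu q U w <= ((n2 + K * eta) `^ (q / 2) * m)%:E)%E) ->
  H_space_neq0 s U u ->
  ((m `^ (1 - 2 / q))%:E <= sobolev_quotient s q U u)%E /\
  (sobolev_quotient s q U u = (m `^ (1 - 2 / q))%:E ->
    exists z, ae_eq_on U u (cst z)).
Proof.
move=> c0 a0 K0 q0 Ka sk momK [Hu u_neq0].
have [mU muU m0 _ _ _ _] := sk.
have [w [j [a2 [[mw wu] Ej Ma2 nH nL]]]] := H_spaceE mU Hu.
have j0 : 0 <= j.
  rewrite -lee_fin -Ej; apply: integral_ge0 => x _.
  by apply: inner_energy_ge0 => z; exact: riesz_kernel_ge0.
have a20 : 0 <= a2.
  by rewrite -lee_fin -Ma2; apply: integral_ge0 => x _; rewrite lee_fin powR_ge0.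
have Eaj : energy mu U (riesz_kernel a s) w = (a * j)%:E.
  by rewrite energy_scale ?(ltW a0)// Ej.
have m_neq0 : m != 0 by rewrite gt_eqF.
(* The seminorm may vanish while [eta] must be positive, so the bound is used for every larger [eta]
   and passed to the limit below. *)
have momq eta : a * j / m < eta ->
    (moment mu q U w <= ((a2 / m + K * eta) `^ (q / 2) * m)%:E)%E.
  move=> eta_gt; apply: momK => //.
  - by rewrite (le_lt_trans _ eta_gt)// divr_ge0 ?mulr_ge0 ?(ltW a0) ?(ltW m0).
  - by rewrite divr_ge0 ?(ltW m0).
  - by rewrite Eaj lee_fin -ler_pdivrMr// ltW.
  - by rewrite Ma2 divfK.
have b_ge0 : (0 <= moment mu q U w)%E.
  by apply: integral_ge0 => x _; rewrite lee_fin powR_ge0.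
have [b bE] : exists b, moment mu q U w = b%:E.
  have := momq (a * j / m + 1) (ltr_pwDr ltr01 (lexx _)).
  by move: b_ge0; case: (moment _ _ _ _) => // b _ _; exists b.
rewrite bE lee_fin in b_ge0.
have b0 : 0 < b.
  rewrite lt_neqAle b_ge0 andbT; apply/eqP => b0; apply: u_neq0.
  have : (\int[mu]_(x in U) `|(`|w x| `^ q)%:E| = 0)%E.
    rewrite -[RHS](_ : moment mu q U w = 0%E); last by rewrite bE -b0.
    by apply: eq_integral => x _; rewrite gee0_abs// lee_fin powR_ge0.
  move=> /(ae_eq_integral_abs _ mU (measurable_moment _ mw)).
  apply: filterS => x + Ux => /(_ Ux) [/powR_eq0_eq0/normr0_eq0].
  by rewrite wu.
pose B := b `^ (2 / q); pose X := m `^ (2 / q).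
have B0 : 0 < B by exact: powR_gt0.
have X0 : 0 < X by exact: powR_gt0.
have BX : m * B <= (a2 + K * a * j) * X.
  suff : B <= (a2 / m + K * (a * j / m)) * X.
    rewrite -(ler_pM2l m0) => /le_trans; apply.
    by rewrite le_eqVlt; apply/orP; left; apply/eqP; field.
  apply/ler_addgt0Pr => e e0.
  have KX0 : 0 < K * X by exact: mulr_gt0.
  (* The excess in [eta] is chosen to contribute exactly [e] to the final bound. *)
  have eta_gt : a * j / m < a * j / m + e / (K * X) by rewrite ltrDl divr_gt0.
  have := momq _ eta_gt; rewrite bE lee_fin => ble.
  set Y := _ + K * _ in ble.
  have Y0 : 0 <= Y.
    rewrite addr_ge0 ?divr_ge0 ?(ltW m0)// mulr_ge0 ?(ltW K0)//.
    by rewrite ltW// (le_lt_trans _ eta_gt)// divr_ge0 ?mulr_ge0 ?(ltW a0) ?(ltW m0).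
  have q2 : 0 <= 2 / q by rewrite divr_ge0 ?(ltW q0).
  have Ym0 : 0 <= Y `^ (q / 2) * m by rewrite mulr_ge0 ?powR_ge0 ?(ltW m0).
  have := ge0_ler_powR q2 _ _ ble; rewrite !nnegrE => /(_ (ltW b0) Ym0).
  rewrite powRM ?powR_ge0 ?(ltW m0)// -powRrM.
  have -> : q / 2 * (2 / q) = 1 by field; rewrite gt_eqF.
  rewrite powRr1// => /le_trans; apply; rewrite -/X /Y.
  rewrite le_eqVlt; apply/orP; left; apply/eqP; field.
  by rewrite m_neq0 !gt_eqF.
have quotE : sobolev_quotient s q U u = ((j + a2) / B)%:E.
  rewrite /sobolev_quotient nH nL// bE poweR_EFin -EFin_expe.
  have bq : 0 < (b `^ q^-1) ^+ 2 by rewrite exprn_gt0// powR_gt0.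
  rewrite inver gt_eqF// -EFinM; congr (_ / _)%:E.
  by rewrite /B -powR_mulrn ?powR_ge0// -powRrM mulrC.
have -> : m `^ (1 - 2 / q) = m / X.
  by rewrite powRB ?powRr1 ?(ltW m0)// (gt_eqF m0) implybT.
rewrite quotE; split.
  rewrite lee_fin ler_pdivrMr// mulrAC ler_pdivlMr// (le_trans BX)//.
  by rewrite ler_pM2r// addrC lerD2r ler_piMl// ltW.
move=> [/(congr1 (fun t => t * B * X))].
rewrite divfK ?gt_eqF// mulrAC divfK ?gt_eqF// => jX.
have j_eq0 : j = 0.
  apply/eqP; rewrite eq_le j0 andbT.
  have : (j + a2) * X <= (a2 + K * a * j) * X by rewrite jX.
  rewrite ler_pM2r// => jle.
  have : (1 - K * a) * j <= 0 by lra.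
  by rewrite pmulr_rle0// subr_gt0.
have [|z wz] := energy_eq0 c0 sk mw; first by rewrite Eaj j_eq0 mulr0.
exists z; apply: filterS wz => x wz Ux; rewrite -wu// wz//.
Qed.

End extremals.

(** * Existence and uniqueness of the extremal *)

Theorem theorem4p4 (R : realType) (n : nat) (Omega : set 'rV[R]_n) (s q : R) :
  (1 <= n)%N ->
  bounded_smooth_domain Omega ->
  0 < s < 1 ->
  1 < q ->
  (q%:E < crit_exponent n s)%E ->
  exists2 delta : R, 0 < delta &
    forall eps : R, 0 < eps < delta ->
      (exists u, extremal s q (contracted_domain eps Omega) u) /\
      (forall u v, extremal s q (contracted_domain eps Omega) u ->
         extremal s q (contracted_domain eps Omega) v ->
         exists2 c : R, c != 0 &
           ae_eq_on (contracted_domain eps Omega) v (fun x => c * u x)).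
Proof.
move=> n0 [[neO _ oO] bO sO] /andP[s0 s1] q1 qcrit.
have q0 : 0 < q by exact: lt_trans q1.
have NR0 : 0 < n%:R :> R by rewrite ltr0n.
have [d d0 cubes] := domain_cubes oO bO sO.
have [D D0 OD] := bounded_set_coord bO.
have [c c0 kernels] := contracted_sobolev_kernel n0 s0 oO neO d0 D0 cubes OD.
have [|K K0 momK] := subcritical_moment_le (lebesgue_rV n) c0 NR0 s0 q0.
  by move: qcrit; rewrite /crit_exponent => + sn; rewrite sn lte_fin.
(* The solution of K delta^(2 s) = 1. *)
pose delta := (K^-1) `^ (2 * s)^-1.
exists delta; first by rewrite powR_gt0// invr_gt0.
move=> eps /andP[eps0 epsd].
have [m sk] := kernels eps eps0.
have [mU muU m0 _ _ _ _] := sk.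
set U := contracted_domain eps Omega in sk mU muU *.
have a0 : 0 < eps `^ (2 * s) by exact: powR_gt0.
have s20 : 0 < 2 * s by exact: mulr_gt0.
have Ka : K * eps `^ (2 * s) < 1.
  rewrite mulrC -ltr_pdivlMr// mul1r.
  have -> : K^-1 = delta `^ (2 * s).
    by rewrite /delta -powRrM mulVf ?gt_eqF// powRr1// invr_ge0 ltW.
  by rewrite gt0_ltr_powR ?nnegrE ?(ltW eps0) ?powR_ge0.
have quot u := @sobolev_quotient_ge R n c s _ m q K U u c0 a0 K0 q0 Ka sk
  (fun w eta n2 mw => momK U _ m w eta n2 sk mw).
have [H1 quot1] := sobolev_quotient_cst1 s q0 m0 mU muU.
have constE : sobolev_constant s q U = (m `^ (1 - 2 / q))%:E.
  apply/eqP; rewrite eq_le; apply/andP; split.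
    by rewrite -quot1; apply: ereal_inf_lbound; exists (cst 1).
  by apply: le_ereal_inf_tmp => _ [u /quot[ge _] <-].
(* The constant is nonzero because an extremal does not vanish almost everywhere on [U]. *)
have cst_extremal u : extremal s q U u -> exists2 z, z != 0 & ae_eq_on U u (cst z).
  move=> [Hu +]; rewrite constE => /(quot u Hu).2 [z uz]; exists z => //.
  by apply: contra_notN Hu.2 => /eqP z0; rewrite -z0.
split; first by exists (cst 1); split=> //; rewrite constE.
move=> u v /cst_extremal[z z0 uz] /cst_extremal[z' z'0 vz'].
exists (z' / z); first by rewrite mulf_neq0// invr_eq0.
apply: filterS2 uz vz' => x ux vx Ux.
by rewrite ux// vx//= divfK.
Qed.
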